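(* Let $G$ be an infinite group with finite generating set $\mathcal S$ whose Cayley graph $X$ (with respect to $\mathcal S$) is $\delta$-hyperbolic. Let $\mathcal L$ be the language of words with letters in $\mathcal S^{\pm1}$ in which every subword of length at most $10\delta$ is a geodesic in $X$. Suppose that for any pair of words $(w_1,w_3)\in\mathcal L\times\mathcal L$ there exists a word $w_2\in\mathcal L$ such that the concatenation $w_1w_2w_3$ also belongs to $\mathcal L$. Then there exist constants $D,R$ with the following property: for every $g\in G$ with $d_X(1_G,g)\ge 10\delta$ there exists an element $\tilde g\in G$ with $d_X(g,\tilde g)\le D$ which acts loxodromically on $X$ (i.e. has infinite order), and whose loxodromic axis in $X$ passes within distance $R$ of the base point $1_G$.
   Context: $G$ acts on its Cayley graph $X$ by isometries, by left multiplication, and the base point of $X$ is the neutral element $1_G$. An element acts loxodromically if $\lim_{n\to\infty}\frac1n d_X(1_G,g^n)$ exists and is positive; it then has exactly two fixed points on $\partial X$. An axis of it is a bi-infinite geodesic in $X$ connecting these two points; the conclusion concerns any such axis. *)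

(* Defs.v *)
From HB Require Import structures.
From mathcomp Require Import all_boot all_order all_algebra.
From mathcomp Require Import all_classical all_reals all_analysis.

Set Implicit Arguments.
Unset Strict Implicit.
Unset Printing Implicit Defensive.

Import Order.TTheory GRing.Theory Num.Theory.
Import numFieldNormedType.Exports.

Local Open Scope classical_set_scope.
Local Open Scope ring_scope.

(* [d] is meant to be a pseudometric: [x] and [y] with [d x y = 0] are two names
   of the same point. Parametrised curves are total functions [R -> T] of which
   only the values on the relevant interval matter. *)
Section PseudometricSpaces.
Context {R : realType} {T : Type} (d : T -> T -> R).

Definition isometric_on (A : set R) (c : R -> T) : Prop :=
  forall s t, A s -> A t -> d (c s) (c t) = `|s - t|.

Definition geodesic_segment (x y : T) (c : R -> T) : Prop :=
  [/\ isometric_on `[0, d x y] c, d (c 0) x = 0 & d (c (d x y)) y = 0].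

Definition geodesic_ray (r : R -> T) : Prop := isometric_on `[0, +oo[ r.

Definition biinfinite_geodesic (c : R -> T) : Prop := isometric_on setT c.

(* Every geodesic triangle is delta-slim. Since x, y, z are arbitrary, it is
   enough to state the condition for the side from x to y. *)
Definition hyperbolic (delta : R) : Prop :=
  forall (x y z : T) (p q r : R -> T),
    geodesic_segment x y p -> geodesic_segment y z q ->
    geodesic_segment z x r ->
    forall t, 0 <= t <= d x y ->
      (exists2 s, 0 <= s <= d y z & d (p t) (q s) <= delta) \/
      (exists2 s, 0 <= s <= d z x & d (p t) (r s) <= delta).

Definition asymptotic (r r' : R -> T) : Prop :=
  exists K : R, forall t, 0 <= t -> d (r t) (r' t) <= K.

(* A point of the boundary at infinity is an asymptoty class of rays. *)
Definition ray_class (r : R -> T) : set (R -> T) :=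
  [set r' | geodesic_ray r' /\ asymptotic r r'].

Definition boundary : set (set (R -> T)) :=
  [set ray_class r | r in geodesic_ray].

Definition boundary_fixed (f : T -> T) : set (set (R -> T)) :=
  [set xi | boundary xi /\ [set f \o r | r in xi] = xi].

(* Intended for a loxodromic isometry [f], whose fixed points on the boundary
   are exactly two: [c] is a bi-infinite geodesic connecting them. *)
Definition axis (f : T -> T) (c : R -> T) : Prop :=
  biinfinite_geodesic c /\
  boundary_fixed f = [set ray_class c; ray_class (fun t => c (- t))].

End PseudometricSpaces.

Section CayleyGraph.
Context {G : groupType} (S : set G).

Definition letter : set G := [set s | S s \/ S (s^-1)%g].

Definition word (w : seq G) : Prop := forall s, s \in w -> letter s.

Definition word_value (w : seq G) : G := (\prod_(s <- w) s)%g.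

Definition generates : Prop :=
  forall g, exists2 w, word w & word_value w = g.

Definition word_norm (g : G) : nat :=
  get [set n | (exists2 w, word w & word_value w = g /\ size w = n) /\
               (forall w, word w -> word_value w = g -> (n <= size w)%N)].

Definition word_dist (g h : G) : nat := word_norm (g^-1 * h)%g.

Definition geodesic_word (w : seq G) : Prop :=
  size w = word_norm (word_value w).

(* The simple graph underlying the Cayley graph: no loops, no multiple edges. *)
Definition adjacent (u v : G) : Prop := u <> v /\ letter (u^-1 * v)%g.

Variable R : realType.

Definition local_geodesic_words (delta : R) : set (seq G) :=
  [set w | word w /\
     forall v, infix v w -> (size v)%:R <= 10 * delta -> geodesic_word v].

(* A point of the geometric realisation, all edges having length 1: the point at
   distance [pos] from [src] on the edge joining [src] to [tgt], or the vertex
   [src] when [src = tgt]. Each point has several such descriptions; they are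
   identified by [cayley_dist] being 0. *)
Record cayley_point := CayleyPoint {
  src : G;
  tgt : G;
  pos : R;
  cayley_pointP : src = tgt \/ adjacent src tgt;
  pos_itv : 0 <= pos <= (src != tgt)%:R
}.

Definition copos (p : cayley_point) : R := (src p != tgt p)%:R - pos p.

(* Length of the shortest path from p to q through an end of the edge of p and
   an end of the edge of q. *)
Definition through_ends (p q : cayley_point) : R :=
  Num.min
    (Num.min (pos p + (word_dist (src p) (src q))%:R + pos q)
             (pos p + (word_dist (src p) (tgt q))%:R + copos q))
    (Num.min (copos p + (word_dist (tgt p) (src q))%:R + pos q)
             (copos p + (word_dist (tgt p) (tgt q))%:R + copos q)).

Definition cayley_dist (p q : cayley_point) : R :=
  if (src p == src q) && (tgt p == tgt q) then `|pos p - pos q|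
  else if (src p == tgt q) && (tgt p == src q) then `|pos p - copos q|
  else through_ends p q.

Lemma vertex_pos_itv (g : G) : 0 <= (0 : R) <= (g != g)%:R.
Proof. by rewrite lexx ler0n. Qed.

Definition vertex (g : G) : cayley_point :=
  @CayleyPoint g g 0 (or_introl erefl) (vertex_pos_itv g).

Lemma adjacent_mull (g u v : G) :
  u = v \/ adjacent u v -> (g * u)%g = (g * v)%g \/ adjacent (g * u)%g (g * v)%g.
Proof.
case=> [->|[nuv luv]]; [by left | right; split; first by move/mulgI].
by rewrite invgM -mulgA mulKg.
Qed.

Lemma pos_itv_mull (g : G) (p : cayley_point) :
  0 <= pos p <= ((g * src p)%g != (g * tgt p)%g)%:R.
Proof. by rewrite (inj_eq (@mulgI G g)); exact: pos_itv. Qed.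

Definition cayley_act (g : G) (p : cayley_point) : cayley_point :=
  CayleyPoint (adjacent_mull g (cayley_pointP p)) (pos_itv_mull g p).

Definition loxodromic (g : G) : Prop :=
  exists2 l : R, 0 < l &
    (fun n : nat => n%:R^-1 * cayley_dist (vertex 1%g) (vertex (g ^+ n)%g)) @ \oo
      --> l.

End CayleyGraph.

(* Main.v *)
(** Let N be the integer part of 10 delta and Delta that of delta.  Vertex
    triangles are Delta-slim, and if N >= 2 then N / 2 > 4 Delta, so a path all
    of whose subpaths of length at most N are geodesic stays within 2 Delta of
    every geodesic joining its ends; in particular its ends drift apart linearly.

    Given a geodesic word w for g, the word w2 with w w2 w in L may be chosen
    to depend only on the first and last N letters of w, hence to have bounded
    length.  Then (w w2)^oo is a periodic local geodesic, so g' = w w2 is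
    loxodromic, and 1 is within 2 Delta of the geodesics from g'^-n to g'^n.
    As g' fixes the ends of its axis c, each g'^n moves c within 2 delta of
    itself, so all powers of g' stay at bounded distance from c, and letting n
    grow puts 1 within 2 delta + 2 Delta of c.

    If N < 2 the language condition is nearly void, but then the Cayley graph
    has no triangle of edges, words are local geodesics for N = 2 as soon as
    they are reduced, and a connecting letter is found by hand because G is
    infinite. *)

Require Import Defs.
From HB Require Import structures.
From mathcomp Require Import all_boot all_order all_algebra.
From mathcomp Require Import all_classical all_reals all_analysis.
From mathcomp Require Import zify ring lra.

Set Implicit Arguments.
Unset Strict Implicit.
Unset Printing Implicit Defensive.

Import Order.TTheory GRing.Theory Num.Theory.
Import numFieldNormedType.Exports.

Local Open Scope classical_set_scope.
Local Open Scope ring_scope.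

(** * Pseudometric geodesic spaces *)

Section PseudometricGeodesics.
Context {R : realType} {T : Type} (d : T -> T -> R).
Hypothesis dxx : forall x, d x x = 0.
Hypothesis d_sym : forall x y, d x y = d y x.
Hypothesis d_tri : forall x y z, d x z <= d x y + d y z.

Lemma pseudo_ge0 x y : 0 <= d x y.
Proof. by have := d_tri x y x; rewrite dxx (d_sym y x); lra. Qed.

Lemma pseudo_eq0 x x' y y' : d x x' = 0 -> d y y' = 0 -> d x y = d x' y'.
Proof.
move=> xx' yy'.
have := d_tri x x' y; have := d_tri x' y' y; have := d_tri x' x y'.
have := d_tri x y y'; rewrite (d_sym x' x) (d_sym y' y) xx' yy'; lra.
Qed.

(** The triangle inequality through [c s] and [c t] leaves no slack: a 1-Lipschitz curve whose ends
    are at least [L] apart can lose length nowhere. *)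
Lemma isometric_of_le (L : R) (c : R -> T) :
    (forall s t, 0 <= s -> s <= t -> t <= L -> d (c s) (c t) <= t - s) ->
  L <= d (c 0) (c L) -> isometric_on d `[0, L] c.
Proof.
move=> le_c Lc.
have iso s t : 0 <= s -> s <= t -> t <= L -> d (c s) (c t) = t - s.
  move=> s0 st tL.
  have := le_c s t s0 st tL; have := le_c 0 s; have := le_c t L.
  have := d_tri (c 0) (c s) (c L); have := d_tri (c s) (c t) (c L); lra.
move=> s t /=; rewrite !in_itv /= => /andP[s0 sL] /andP[t0 tL].
have [st|/ltW ts] := leP s t.
  by rewrite iso // distrC ger0_norm // subr_ge0.
by rewrite d_sym iso // ger0_norm // subr_ge0.
Qed.

Lemma geodesic_dist x y c s t : geodesic_segment d x y c ->
  0 <= s <= d x y -> 0 <= t <= d x y -> d (c s) (c t) = `|s - t|.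
Proof. by case=> iso _ _ ? ?; apply: iso; rewrite /= in_itv. Qed.

Lemma geodesic_dist_source x y c t : geodesic_segment d x y c ->
  0 <= t <= d x y -> d x (c t) = t.
Proof.
move=> gc t_in; rewrite (@pseudo_eq0 x (c 0) (c t) (c t)) ?dxx //.
  rewrite (geodesic_dist gc) // ?lexx ?pseudo_ge0 //.
  by rewrite sub0r normrN ger0_norm //; case/andP: t_in.
by rewrite d_sym; case: gc.
Qed.

Lemma geodesic_dist_target x y c t : geodesic_segment d x y c ->
  0 <= t <= d x y -> d (c t) y = d x y - t.
Proof.
move=> gc t_in; rewrite (@pseudo_eq0 (c t) (c t) y (c (d x y))) ?dxx //.
  rewrite (geodesic_dist gc) // ?lexx ?pseudo_ge0 //.
  by rewrite distrC ger0_norm //; case/andP: t_in; lra.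
by rewrite d_sym; case: gc.
Qed.

Lemma geodesic_ends x x' y y' c : d x x' = 0 -> d y y' = 0 ->
  geodesic_segment d x y c -> geodesic_segment d x' y' c.
Proof.
move=> xx' yy' [iso c0 c1]; split; rewrite -?(pseudo_eq0 xx' yy') //.
  by rewrite -(pseudo_eq0 (dxx _) xx').
by rewrite -(pseudo_eq0 (dxx _) yy').
Qed.

Lemma geodesic_rev x y c : geodesic_segment d x y c ->
  geodesic_segment d y x (fun t => c (d x y - t)).
Proof.
move=> [iso c0 c1]; rewrite /geodesic_segment (d_sym y x); split.
- move=> s t /=; rewrite !in_itv /= => s_in t_in.
  by rewrite iso /= ?in_itv /=; [rewrite distrC; congr `|_|; lra| lra | lra].
- by rewrite subr0.
- by rewrite subrr.
Qed.

Lemma geodesic_const x y (c : R -> T) : d x y = 0 -> d (c 0) x = 0 ->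
  geodesic_segment d x y c.
Proof.
move=> xy cx; rewrite /geodesic_segment xy; split => //.
  move=> s t /=; rewrite !in_itv /= => s0 t0.
  have -> : s = 0 by lra.
  have -> : t = 0 by lra.
  by rewrite dxx subrr normr0.
by rewrite -(pseudo_eq0 (dxx _) xy).
Qed.

Lemma geodesic_sub_ray (a b : R) (c : R -> T) : biinfinite_geodesic d c ->
  a <= b -> geodesic_segment d (c a) (c b) (fun t => c (a + t)).
Proof.
move=> bc ab.
have dab : d (c a) (c b) = b - a by rewrite bc //= distrC ger0_norm ?subr_ge0.
rewrite /geodesic_segment dab; split.
- by move=> s t _ _; rewrite bc //=; congr `|_|; lra.
- by rewrite addr0.
- by rewrite addrC subrK.
Qed.

Definition concat_path (a : R) (p q : R -> T) : R -> T :=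
  fun t => if t <= a then p t else q (t - a).

Lemma geodesic_concat x y z p q :
    geodesic_segment d x y p -> geodesic_segment d y z q ->
    d x y + d y z <= d x z ->
  geodesic_segment d x z (concat_path (d x y) p q).
Proof.
move=> gp gq xyz; have xyzE : d x z = d x y + d y z.
  by apply/le_anti; rewrite xyz d_tri.
have xy0 := pseudo_ge0 x y; have yz0 := pseudo_ge0 y z.
have c0 : d (concat_path (d x y) p q 0) x = 0.
  by rewrite /concat_path xy0; case: gp.
have c1 : d (concat_path (d x y) p q (d x z)) z = 0.
  (* If [d y z = 0], the final time still falls in the branch of [p], which ends at distance 0 from
     [z]. *)
  rewrite /concat_path xyzE; case: ifP => [yz_le|_].
    have yzE : d y z = 0 by lra.
    by rewrite yzE addr0 -(pseudo_eq0 (dxx _) yzE); case: gp.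
  by rewrite addrAC subrr add0r; case: gq.
split => //; apply: isometric_of_le.
  move=> s t s0 st tL; rewrite /concat_path.
  case: ifP => [sp|/negbT]; case: ifP => [tp|/negbT].
  - by rewrite (geodesic_dist gp) ?s0 ?(le_trans s0) // distrC ger0_norm ?subr_ge0.
  - rewrite -ltNge => tq; apply: le_trans (d_tri _ y _) _.
    rewrite (geodesic_dist_target gp) ?s0 // (geodesic_dist_source gq); lra.
  - by rewrite -ltNge; lra.
  - rewrite -!ltNge => tq sq.
    by rewrite (geodesic_dist gq); [rewrite distrC ger0_norm | | ]; lra.
by rewrite (pseudo_eq0 c0 c1).
Qed.

Lemma concat_path_middle x y z p q : geodesic_segment d x y p ->
  geodesic_segment d y z q -> d (concat_path (d x y) p q (d x y)) y = 0.
Proof. by move=> gp _; rewrite /concat_path lexx; case: gp. Qed.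

(** * Consequences of slim triangles *)

Hypothesis d_geod : forall x y, exists c, geodesic_segment d x y c.
Variable delta : R.
Hypothesis d_hyp : hyperbolic d delta.

Lemma hyperbolic_ge0 (x : T) : 0 <= delta.
Proof.
have gx : geodesic_segment d x x (fun=> x) by apply: geodesic_const; rewrite dxx.
have [|[s _]|[s _]] := d_hyp gx gx gx (t := 0); rewrite ?dxx ?lexx //.
Qed.

(* Cut the quadrilateral x, y, y', x' along the diagonal from x to y'. *)
Lemma quadrilateral_slim (C : R) x y x' y' p q t :
    geodesic_segment d x y p -> geodesic_segment d x' y' q ->
    d x x' <= C -> d y y' <= C -> 0 <= t <= d x y ->
  (exists2 s, 0 <= s <= d x' y' & d (p t) (q s) <= 2 * delta) \/
  d (p t) x <= 2 * delta + C \/ d (p t) y <= 2 * delta + C.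
Proof.
move=> gp gq xx' yy' t_in; have dl0 := hyperbolic_ge0 x.
have [e ge] := d_geod y' x; have [r gr] := d_geod y y'.
have [r' gr'] := d_geod x x'.
have [[s s_in ps]|[s s_in ps]] := d_hyp gp gr ge t_in.
  right; right; apply: le_trans (d_tri _ (r s) _) _.
  by rewrite (d_sym (r s)) (geodesic_dist_source gr) //; lra.
have [[u u_in su]|[u u_in su]] := d_hyp ge gr' gq s_in.
  right; left; apply: le_trans (d_tri _ (e s) _) _.
  have := d_tri (e s) (r' u) x.
  by rewrite (d_sym (r' u)) (geodesic_dist_source gr') //; lra.
left; exists u => //; apply: le_trans (d_tri _ (e s) _) _; lra.
Qed.

(* K does not enter the bound: cut both curves at times t - M and t + M with M
   much larger than K, so that the short sides are far from c' t. *)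
Lemma biinfinite_geodesic_close (K : R) (c c' : R -> T) :
    biinfinite_geodesic d c -> biinfinite_geodesic d c' ->
    (forall t, d (c' t) (c t) <= K) ->
  forall t, exists s, d (c' t) (c s) <= 2 * delta.
Proof.
move=> gc gc' cc' t; have dl0 := hyperbolic_ge0 (c 0).
have K0 : 0 <= K by apply: le_trans (cc' 0); apply: pseudo_ge0.
pose M := 2 * delta + K + 1.
have le_ab : t - M <= t + M by rewrite /M; lra.
have dE u v : u <= v -> d (c' u) (c' v) = v - u.
  by move=> uv; rewrite gc' //= distrC ger0_norm ?subr_ge0.
have [||//|] := quadrilateral_slim (t := M) (geodesic_sub_ray gc' le_ab)
  (geodesic_sub_ray gc le_ab) (cc' _).
- exact: cc'.
- by rewrite dE // /M; lra.
- by move=> [s _]; rewrite subrK => ts; exists (t - M + s).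
- by rewrite subrK d_sym !dE /M; lra.
Qed.

(** Since [h \o c] is a geodesic at bounded distance from [c], the resulting bound keeps no trace of
    [K]. It thus serves all powers of an isometry at once, although their displacements along [c]
    may grow. *)
Lemma orbit_close_geodesic (K rho : R) (h : T -> T) (c : R -> T) (o : T) (t0 : R) :
    biinfinite_geodesic d c -> (forall x y, d (h x) (h y) = d x y) ->
    (forall t, d (h (c t)) (c t) <= K) -> d o (c t0) <= rho ->
  exists s, d (h o) (c s) <= rho + 2 * delta.
Proof.
move=> gc h_iso hK o_c.
have ghc : biinfinite_geodesic d (h \o c) by move=> s t ? ? /=; rewrite h_iso gc.
have [s hs] := biinfinite_geodesic_close gc ghc hK t0.
exists s; apply: le_trans (d_tri _ (h (c t0)) _) _.
by rewrite h_iso; apply: lerD.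
Qed.

(** In the quadrilateral formed by [p] and the part of [c] between [s1] and [s2], the point [p t] is
    too far from [x] and [y] for the short sides to matter. *)
Lemma far_geodesic_close (C : R) (c : R -> T) x y p t s1 s2 :
    biinfinite_geodesic d c -> geodesic_segment d x y p -> 0 <= t <= d x y ->
    d x (c s1) <= C -> d y (c s2) <= C ->
    2 * delta + C < d (p t) x -> 2 * delta + C < d (p t) y ->
  exists s, d (p t) (c s) <= 2 * delta.
Proof.
move=> gc gp t_in xc yc ptx pty.
have [s12|/ltW s21] := leP s1 s2.
  have [[u _ pu]|[|]] := quadrilateral_slim gp (geodesic_sub_ray gc s12) xc yc t_in.
  - by exists (s1 + u).
  - by lra.
  - by lra.
(* Here [c] passes [s2] first, so its piece is run backwards. *)
have [[u _ pu]|[|]] :=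
  quadrilateral_slim gp (geodesic_rev (geodesic_sub_ray gc s21)) xc yc t_in.
- by eexists; exact: pu.
- by lra.
- by lra.
Qed.

End PseudometricGeodesics.

(** * Discrete geodesics and local geodesics *)

Section NatMetric.
Local Open Scope nat_scope.
Context {V : Type} (d : V -> V -> nat).
Hypothesis dxx : forall x, d x x = 0.
Hypothesis d_sym : forall x y, d x y = d y x.
Hypothesis d_tri : forall x y z, d x z <= d x y + d y z.

(** [N] is the scale and [L] the length; for [N = L] this is a geodesic, as in
    [discrete_geodesic]. *)
Definition local_geodesic (N L : nat) (c : nat -> V) : Prop :=
  forall i j, i <= j -> j <= L -> j <= i + N -> d (c i) (c j) = j - i.

Definition discrete_geodesic (x y : V) (c : nat -> V) : Prop :=
  [/\ c 0 = x, c (d x y) = y & local_geodesic (d x y) (d x y) c].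

Definition between (x y u : V) : Prop := d x u + d u y = d x y.

(* The side from x to y may be any geodesic through u, the side from y to z is
   given by q, the side from z to x is any geodesic. *)
Definition discrete_slim (Delta : nat) : Prop :=
  forall (x y z u : V) (q : nat -> V), between x y u ->
    discrete_geodesic y z q ->
    (exists2 j, j <= d y z & d u (q j) <= Delta) \/
    (exists2 w, between z x w & d u w <= Delta).

Lemma betweenC x y u : between x y u -> between y x u.
Proof. by rewrite /between (d_sym y x) (d_sym y u) (d_sym u x) addnC. Qed.

Lemma discrete_geodesic_dist x y c i j : discrete_geodesic x y c ->
  i <= j -> j <= d x y -> d (c i) (c j) = j - i.
Proof. by case=> _ _ gc ij jd; apply: gc => //; lia. Qed.

Lemma discrete_geodesic_between x y c j : discrete_geodesic x y c ->
  j <= d x y -> between x y (c j).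
Proof.
move=> gc jd; case: (gc) => c0 cd _; rewrite /between.
have := discrete_geodesic_dist gc (leq0n j) jd.
by have := discrete_geodesic_dist gc jd (leqnn _); rewrite c0 cd; lia.
Qed.

(** Provides a side of a polygon that runs along a given geodesic, backwards if [j < i]. *)
Lemma discrete_geodesic_sub x y c i j : discrete_geodesic x y c ->
    i <= d x y -> j <= d x y ->
  exists2 q, discrete_geodesic (c i) (c j) q &
    forall k, k <= d (c i) (c j) -> exists2 l, l <= d x y & q k = c l.
Proof.
move=> gc id jd; have dE := discrete_geodesic_dist gc.
have [ij|ji] := leqP i j.
  exists (fun k => c (i + k)); rewrite /discrete_geodesic dE //.
    split; [by rewrite addn0 | by rewrite subnKC |].
    by move=> k l kl lj _; rewrite dE; lia.
  by move=> k kij; exists (i + k) => //; lia.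
exists (fun k => c (i - k)); rewrite /discrete_geodesic d_sym dE ?(ltnW ji) //.
  split; [by rewrite subn0 | by rewrite subKn // ltnW |].
  by move=> k l kl lj _; rewrite d_sym dE; lia.
by move=> k kij; exists (i - k) => //; lia.
Qed.

Hypothesis d_geod : forall x y, exists c, discrete_geodesic x y c.
Variables (Delta N m : nat).
Hypothesis slim : discrete_slim Delta.
Hypothesis mN : m + m <= N.
Hypothesis m_gt : 4 * Delta < m.

(* At a vertex x of c as far as possible from g, draw the geodesic
   quadrilateral with vertices y, z on c at distance m before and after x, and
   their nearest points y', z' on g. As x is far from the sides [y, y'] and
   [z, z'] by maximality, it is close to [y', z'], which is part of g. *)
Lemma local_geodesic_close (L : nat) (c g : nat -> V) (k : nat) :
    local_geodesic N L c -> discrete_geodesic (c 0) (c L) g -> k <= L ->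
  exists2 j, j <= d (c 0) (c L) & d (c k) (g j) <= 2 * Delta.
Proof.
move=> lc gg kL; set M := d (c 0) (c L) in gg *.
pose J i := [arg min_(j < (ord0 : 'I_M.+1)) d (c i) (g j)].
pose D i := d (c i) (g (J i)).
have D_le i j : j <= M -> D i <= d (c i) (g j).
  rewrite -ltnS => jM; rewrite /D /J; case: arg_minnP => // l _ lmin.
  exact: (lmin (Ordinal jM)).
have JM i : J i <= M by rewrite -ltnS.
have [x xL xmax] : exists2 x, x <= L & forall i, i <= L -> D i <= D x.
  exists [arg max_(i > (ord0 : 'I_L.+1)) D i]; first by rewrite -ltnS.
  case: arg_maxnP => // l _ lmax i; rewrite -ltnS => iL.
  exact: (lmax (Ordinal iL)).
suff Dx : D x <= 2 * Delta.
  by exists (J k) => //; apply: leq_trans Dx; apply: xmax.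
have [g0 gM ggeo] := gg.
have D0 : D 0 = 0 by have := D_le 0 0 (leq0n _); rewrite g0 dxx leqn0 => /eqP.
have DL : D L = 0 by have := D_le L M (leqnn _); rewrite gM dxx leqn0 => /eqP.
(* If [c a] is at distance [m > 4 * Delta] from [c x], then [w] is more than [2 * Delta] away from
   [c a], so that [D x <= 2 * Delta + d w (g (J a)) < D a], against maximality. At the ends
   [D a = 0], and [w] is the point [g (J a)] up to distance 0. *)
have end_close a w : a <= L -> a = 0 \/ a = L \/ d (c x) (c a) = m ->
    between (c a) (g (J a)) w -> d (c x) w <= 2 * Delta -> D x <= 2 * Delta.
  move=> aL a_end; rewrite /between -/(D a) => aw xw.
  have Dxa := D_le x (J a) (JM a); have := d_tri (c x) w (g (J a)).
  have := d_tri (c x) w (c a); rewrite (d_sym w (c a)).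
  have := xmax a aL.
  case: a_end => [a0|[a1|am]].
  - have : D a = 0 by rewrite a0.
    by lia.
  - have : D a = 0 by rewrite a1.
    by lia.
  - by lia.
(* Cut off at the ends of the path, where [D] vanishes. As [b - a <= m + m <= N], the piece of [c]
   from [a] to [b] is a geodesic through [c x]. *)
pose a := x - m; pose b := minn L (x + m).
have a_end : a = 0 \/ a = L \/ d (c x) (c a) = m.
  have [xm|/ltnW mx] := leqP x m; [left; rewrite /a; lia | right; right].
  by rewrite d_sym lc /a; lia.
have b_end : b = 0 \/ b = L \/ d (c x) (c b) = m.
  right; have [xm|/ltnW mx] := leqP L (x + m); [left; rewrite /b; lia | right].
  by rewrite lc /b; lia.
have aL : a <= L by rewrite /a; lia.
have bL : b <= L by rewrite /b; lia.
have xab : between (c a) (c b) (c x) by rewrite /between !lc /a /b; lia.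
have [q gq] := d_geod (c b) (g (J b)).
have [[j jq xq]|[w ybw xw]] := slim xab gq.
  by apply: (end_close b (q j)) => //; [apply: discrete_geodesic_between | lia].
have [r gr r_g] := discrete_geodesic_sub gg (JM b) (JM a).
have [[j jr wr]|[w' w'a ww']] := slim (betweenC ybw) gr.
  have [l lM rl] := r_g j jr.
  have := D_le x l lM; have := d_tri (c x) w (g l); rewrite -rl; lia.
apply: (end_close a w') => //; first exact: betweenC.
by have := d_tri (c x) w w'; lia.
Qed.

(** A geodesic from [c 0] to [c (L + m)] passes within [2 * Delta] of [c L], so at most [4 * Delta]
    is lost against the sum of [d (c 0) (c L)] and [d (c L) (c (L + m)) = m]. *)
Lemma local_geodesic_growth (c : nat -> V) (L : nat) :
    (forall K, local_geodesic N K c) ->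
  d (c 0) (c L) < d (c 0) (c (L + m)).
Proof.
move=> lc; have [g gg] := d_geod (c 0) (c (L + m)).
have [j jM Lj] := local_geodesic_close (lc _) gg (leq_addr m L).
have := discrete_geodesic_between gg jM; rewrite /between.
have := lc (L + m) L (L + m); have := d_tri (c 0) (g j) (c L).
have := d_tri (c L) (g j) (c (L + m)); rewrite (d_sym (g j) (c L)); lia.
Qed.

Lemma local_geodesic_lower_bound (c : nat -> V) (k : nat) :
  (forall K, local_geodesic N K c) -> k <= d (c 0) (c (k * m)).
Proof.
move=> lc; elim: k => // k IH; rewrite mulSn addnC.
exact: leq_trans (local_geodesic_growth _ lc).
Qed.

End NatMetric.

(** * The word metric *)

Section WordMetric.
Local Open Scope nat_scope.
Local Open Scope group_scope.
Context {G : groupType} (S : set G).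
Hypothesis gen_S : generates S.
Local Notation wd := (word_dist S).
Local Notation norm := (word_norm S).

Lemma word_cat (v w : seq G) : word S (v ++ w) <-> word S v /\ word S w.
Proof.
split=> [vw|[wv ww] s]; last by rewrite mem_cat => /orP[/wv|/ww].
by split=> s sv; apply: vw; rewrite mem_cat sv ?orbT.
Qed.

Lemma word_infix (v w : seq G) : infix v w -> word S w -> word S v.
Proof. by move=> vw ww s /(mem_infix vw)/ww. Qed.

Lemma word_value_cat (v w : seq G) :
  word_value (v ++ w) = word_value v * word_value w.
Proof. exact: big_cat. Qed.

Lemma letterV s : letter S s -> letter S s^-1.
Proof. by rewrite /letter /= invgK => -[]; [right | left]. Qed.

Lemma word_inv (w : seq G) : word S w ->
  exists2 v, word S v & word_value v = (word_value w)^-1 /\ size v = size w.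
Proof.
move=> ww; exists (rev [seq s^-1 | s <- w]).
  by move=> s; rewrite mem_rev => /mapP[t /ww lt ->]; apply: letterV.
split; last by rewrite size_rev size_map.
elim: w {ww} => [|s w IH]; first by rewrite /word_value big_nil invg1.
rewrite map_cons rev_cons -cats1 word_value_cat IH {3}/word_value big_cons.
by rewrite invgM /word_value big_seq1.
Qed.

(** [get] is meaningful on a nonempty set only; since [S] generates [G], a shortest word for [g]
    exists. *)
Lemma word_norm_spec (g : G) :
  (exists2 w, word S w & word_value w = g /\ size w = norm g) /\
  (forall w, word S w -> word_value w = g -> norm g <= size w).
Proof.
suff /getPex : exists n, [set n |
    (exists2 w, word S w & word_value w = g /\ size w = n) /\
    (forall w, word S w -> word_value w = g -> n <= size w)] n by [].
pose P n := `[< exists2 w, word S w & word_value w = g /\ size w = n >].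
have exP : exists n, P n.
  have [w ww wg] := gen_S g; exists (size w); apply/asboolP; by exists w.
case: (ex_minnP exP) => n /asboolP Pn nmin; exists n; split => // w ww wg.
by apply: nmin; apply/asboolP; exists w.
Qed.

Lemma geodesic_word_exists (g : G) :
  exists w, [/\ word S w, word_value w = g & geodesic_word S w].
Proof.
have [[w ww [wg wn]] _] := word_norm_spec g.
by exists w; split => //; rewrite /geodesic_word wg.
Qed.

Lemma word_norm_le (w : seq G) : word S w -> norm (word_value w) <= size w.
Proof. by move=> ww; case: (word_norm_spec (word_value w)) => _; apply. Qed.

Lemma word_norm1 : norm 1 = 0%N.
Proof.
have : word S [::] by [].
by move/word_norm_le; rewrite /word_value big_nil leqn0 => /eqP.
Qed.

Lemma word_norm_eq0 g : norm g = 0%N -> g = 1.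
Proof.
have [w [_ <- gw]] := geodesic_word_exists g.
by rewrite -gw => /size0nil->; rewrite /word_value big_nil.
Qed.

Lemma word_normM g h : norm (g * h) <= norm g + norm h.
Proof.
have [v [wv vg gv]] := geodesic_word_exists g.
have [w [ww wh gw]] := geodesic_word_exists h.
have vw : word S (v ++ w) by apply/word_cat.
by have := word_norm_le vw; rewrite word_value_cat vg wh size_cat gv gw vg wh.
Qed.

Lemma word_normV g : norm g^-1 = norm g.
Proof.
suff le_norm h : norm h^-1 <= norm h.
  by apply/eqP; rewrite eqn_leq le_norm -{1}(invgK g) le_norm.
have [w [ww <- gw]] := geodesic_word_exists h.
have [v wv [<- vw]] := word_inv ww.
by apply: leq_trans (word_norm_le wv) _; rewrite vw gw.
Qed.

Lemma word_norm_letter s : letter S s -> s <> 1 -> norm s = 1%N.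
Proof.
move=> ls s1; have : word S [:: s] by move=> t; rewrite inE => /eqP->.
move/word_norm_le; rewrite /word_value big_seq1 /=.
by case: (norm s) (@word_norm_eq0 s) => [/(_ erefl)//|[|//]].
Qed.

Lemma letter_of_word_norm s : norm s = 1%N -> letter S s.
Proof.
have [w [ww <- gw]] := geodesic_word_exists s; rewrite -gw.
case: w ww {gw} => [//|t [|//]] wt _.
by rewrite /word_value big_seq1; apply: wt; rewrite inE.
Qed.

(** A shorter word for the value of [v] could be substituted in [w]. *)
Lemma geodesic_infix (v w : seq G) : infix v w -> word S w ->
  geodesic_word S w -> geodesic_word S v.
Proof.
move=> /infixP[p [q ->]] /word_cat[wp /word_cat[wv wq]].
rewrite /geodesic_word !word_value_cat !size_cat => E.
have := word_norm_le wp; have := word_norm_le wv; have := word_norm_le wq.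
have := word_normM (word_value p) (word_value v * word_value q).
have := word_normM (word_value v) (word_value q); lia.
Qed.

Lemma word_dist_self g : wd g g = 0%N.
Proof. by rewrite /word_dist mulVg word_norm1. Qed.

Lemma word_dist_sym g h : wd g h = wd h g.
Proof. by rewrite /word_dist -word_normV invgM invgK. Qed.

Lemma word_dist_tri g h k : wd g k <= wd g h + wd h k.
Proof.
by have := word_normM (g^-1 * h) (h^-1 * k); rewrite mulgA mulgK.
Qed.

Lemma word_dist_mull k g h : wd (k * g) (k * h) = wd g h.
Proof. by rewrite /word_dist invgM -mulgA mulKg. Qed.

Lemma word_dist_1 g : wd 1 g = norm g.
Proof. by rewrite /word_dist invg1 mul1g. Qed.

Lemma word_dist_adjacent g h : g = h \/ Defs.adjacent S g h -> wd g h = (g != h).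
Proof.
case=> [->|[/eqP/[dup] gh -> lgh]]; first by rewrite word_dist_self eqxx.
rewrite /word_dist word_norm_letter // => /eqP; rewrite mulg_eq1 => /eqP/invg_inj.
exact/eqP.
Qed.

Lemma word_dist_eq1 g h : wd g h = 1%N -> Defs.adjacent S g h.
Proof.
move=> gh; split=> [ghE|]; last exact: letter_of_word_norm.
by move: gh; rewrite ghE word_dist_self.
Qed.

Lemma word_dist_prefixes (x : G) (w : seq G) i j : i <= j ->
  wd (x * word_value (take i w)) (x * word_value (take j w)) =
  norm (word_value (drop i (take j w))).
Proof.
move=> ij; rewrite word_dist_mull /word_dist -{1}(cat_take_drop i (take j w)).
by rewrite take_takel // word_value_cat mulKg.
Qed.

Lemma word_discrete_geodesic (x y : G) :
  exists c, discrete_geodesic wd x y c.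
Proof.
have [w [ww wxy gw]] := geodesic_word_exists (x^-1 * y).
exists (fun i => x * word_value (take i w)); split.
- by rewrite take0 /word_value big_nil mulg1.
- by rewrite /word_dist -wxy -gw take_size wxy mulVKg.
move=> i j ij jL _; rewrite word_dist_prefixes //.
have sub : infix (drop i (take j w)) w.
  by apply: infix_trans (infix_drop _ _) (infix_take _ _).
rewrite -(geodesic_infix sub ww gw) size_drop size_takel //.
by rewrite gw wxy.
Qed.

End WordMetric.

(** * The geometric realisation of the Cayley graph *)

Section CayleyMetric.
Context {R : realType} {G : groupType} (S : set G).
Hypothesis gen_S : generates S.
Local Notation wd := (word_dist S).
Local Notation pt := (cayley_point S R).
Local Notation cd := (@cayley_dist G S R).
Local Notation vx := (vertex S R).

(** With ends indexed by booleans, the four routes of [through_ends] become one formula and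
    reversing an edge becomes an exclusive or. *)
Definition cend (b : bool) (p : pt) : G := if b then tgt p else src p.
Definition coff (b : bool) (p : pt) : R := if b then copos p else pos p.

Lemma coff_ge0 b p : 0 <= coff b p.
Proof. by have := pos_itv p; case: b; rewrite /= /copos; lra. Qed.

Lemma coffN b p : coff (~~ b) p = (wd (cend b p) (cend (~~ b) p))%:R - coff b p.
Proof.
have E := word_dist_adjacent gen_S (cayley_pointP p).
case: b => /=; rewrite ?(word_dist_sym gen_S (tgt p)) E /copos //.
by rewrite opprB addrC subrK.
Qed.

Lemma coff_vertex b g : coff b (vx g) = 0.
Proof. by case: b; rewrite /= /copos /= ?eqxx ?subr0. Qed.

Lemma cend_vertex b g : cend b (vx g) = g.
Proof. by case: b. Qed.

Lemma through_ends_le b b' p q :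
  through_ends p q <= coff b p + (wd (cend b p) (cend b' q))%:R + coff b' q.
Proof. by case: b b' => -[]; rewrite /through_ends !ge_min /= lexx ?orbT. Qed.

Lemma through_ends_ex p q : exists b b',
  through_ends p q = coff b p + (wd (cend b p) (cend b' q))%:R + coff b' q.
Proof.
rewrite /through_ends /Num.min; case: ifP => _; case: ifP => _.
- by exists false, false.
- by exists false, true.
- by exists true, false.
- by exists true, true.
Qed.

(* sigma tells whether p and q describe their common edge in opposite directions. *)
Definition same_edge (sigma : bool) (p q : pt) : Prop :=
  forall b, cend b q = cend (b (+) sigma) p.

Lemma same_edge_dist sigma b p q : same_edge sigma p q ->
  cd p q = `|coff (b (+) sigma) p - coff b q|.
Proof.
move=> pq; have Es := pq false; have Et := pq true.
have [p1 p2] := andP (pos_itv p); have [q1 q2] := andP (pos_itv q).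
case: sigma {pq} Es Et => /= qs qt; rewrite /cayley_dist qs qt !eqxx ?andbT /=.
  (* A description with [src p = tgt p] passes the first test of [cayley_dist] as well; all offsets
     are then 0. *)
  case: eqP => [st|_].
    have p0 : pos p = 0 by apply: le_anti; rewrite p1 andbT; move: p2; rewrite st eqxx.
    have q0 : pos q = 0.
      by apply: le_anti; rewrite q1 andbT; move: q2; rewrite qs qt st eqxx.
    by case: b; rewrite /= /copos p0 q0 qs qt st eqxx !subrr.
  case: b => /=; rewrite /copos qs qt (eq_sym (tgt p)); first by [].
  by rewrite -(normrN (pos p - _)); congr `|_|; lra.
by case: b => //=; rewrite /copos qs qt -normrN; congr `|_|; lra.
Qed.

Lemma cayley_dist_cases p q : (exists sigma, same_edge sigma p q) \/
  exists b b', cd p q = coff b p + (wd (cend b p) (cend b' q))%:R + coff b' q.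
Proof.
have [/andP[/eqP ss /eqP tt]|n1] := boolP ((src p == src q) && (tgt p == tgt q)).
  by left; exists false => -[].
have [/andP[/eqP ss /eqP tt]|n2] := boolP ((src p == tgt q) && (tgt p == src q)).
  by left; exists true => -[].
right; rewrite /cayley_dist (negPf n1) (negPf n2); exact: through_ends_ex.
Qed.

(** On a common edge too, a route through ends is no shorter than the direct segment. Upper bounds
    on the distance thus reduce to a choice of ends. *)
Lemma cayley_dist_le b b' p q :
  cd p q <= coff b p + (wd (cend b p) (cend b' q))%:R + coff b' q.
Proof.
rewrite /cayley_dist; case: ifP => [/andP[/eqP ss /eqP tt]|n1].
  have /(same_edge_dist b') : same_edge false p q by case.
  rewrite /cayley_dist ss tt !eqxx /= => ->; rewrite addbF.
  have := coffN b p; have := coff_ge0 (~~ b) p; have := coff_ge0 b p.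
  have := coff_ge0 b' q; have := coff_ge0 (~~ b') q.
  have -> : cend b' q = cend b' p by case: (b'); rewrite /= ?ss ?tt.
  by case: b b' => -[] /=; rewrite ?(word_dist_self gen_S) ler_norml /=; lra.
case: ifP => [/andP[/eqP ss /eqP tt]|n2]; last exact: through_ends_le.
have /(same_edge_dist b') : same_edge true p q by case.
rewrite /cayley_dist n1 ss tt !eqxx /= => ->; rewrite addbT.
have := coffN b p; have := coff_ge0 (~~ b) p; have := coff_ge0 b p.
have := coff_ge0 b' q; have := coff_ge0 (~~ b') q.
have -> : cend b' q = cend (~~ b') p by case: (b'); rewrite /= ?ss ?tt.
by case: b b' => -[] /=; rewrite ?(word_dist_self gen_S) ler_norml /=; lra.
Qed.

Lemma cayley_dist_self p : cd p p = 0.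
Proof. by rewrite /cayley_dist !eqxx /= subrr normr0. Qed.

Lemma cayley_dist_sym p q : cd p q = cd q p.
Proof.
suff le_sym p' q' : cd p' q' <= cd q' p' by apply: le_anti; rewrite !le_sym.
have [[sigma qp]|[b [b' ->]]] := cayley_dist_cases q' p'.
  have pq : same_edge sigma p' q'.
    by move=> b; rewrite qp; case: sigma {qp} b => -[].
  rewrite (same_edge_dist sigma qp) (same_edge_dist false pq) distrC.
  by rewrite addbb.
apply: le_trans (cayley_dist_le b' b _ _) _.
by rewrite (word_dist_sym gen_S (cend b' p')); lra.
Qed.

Lemma cayley_dist_tri p q r : cd p r <= cd p q + cd q r.
Proof.
have [[s pq]|[b [b' ->]]] := cayley_dist_cases p q.
  have [[s' qr]|[b [b' ->]]] := cayley_dist_cases q r.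
    have pr : same_edge (s' (+) s) p r by move=> b; rewrite qr pq addbA.
    rewrite (same_edge_dist false pr) (same_edge_dist s' pq).
    by rewrite (same_edge_dist false qr) !addFb ler_distD.
  rewrite (same_edge_dist b pq).
  apply: le_trans (cayley_dist_le (b (+) s) b' p r) _; rewrite pq.
  have := ler_norm (coff (b (+) s) p - coff b q); lra.
have [[s qr]|[b1 [b1' ->]]] := cayley_dist_cases q r.
  apply: le_trans (cayley_dist_le b (b' (+) s) p r) _.
  have -> : cend (b' (+) s) r = cend b' q by rewrite qr -addbA addbb addbF.
  rewrite (same_edge_dist (b' (+) s) qr) -addbA addbb addbF distrC.
  have := ler_norm (coff (b' (+) s) r - coff b' q); lra.
apply: le_trans (cayley_dist_le b b1' p r) _.
(* The two routes meet the edge of [q] either at the same end or at opposite ends; in the latter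
   case their offsets add up to the length of that edge. *)
have := coffN b' q; have := coff_ge0 b' q.
have := word_dist_tri gen_S (cend b p) (cend b' q) (cend b1' r).
have := word_dist_tri gen_S (cend b' q) (cend b1 q) (cend b1' r).
rewrite -!(ler_nat R) !natrD.
have [->|/negPf/esym/eqP] := eqVneq b1 b'; first by lra.
by case: b' => /=; case: b1 => //= _; lra.
Qed.

Lemma cayley_dist_act g p q : cd (cayley_act g p) (cayley_act g q) = cd p q.
Proof.
rewrite /cayley_dist /through_ends /copos /=.
by rewrite !(inj_eq (@mulgI G g)) !(word_dist_mull).
Qed.

Lemma vertex_dist_ex g p : exists b,
  cd (vx g) p = (wd g (cend b p))%:R + coff b p.
Proof.
have [[s gp]|[b [b' ->]]] := cayley_dist_cases (vx g) p.
  exists false; rewrite (same_edge_dist false gp) coff_vertex gp cend_vertex.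
  by rewrite (word_dist_self gen_S) !add0r normrN ger0_norm ?coff_ge0.
by exists b'; rewrite coff_vertex cend_vertex add0r.
Qed.

Lemma vertex_dist_le g p : exists b, (wd g (cend b p))%:R <= cd (vx g) p.
Proof.
by have [b ->] := vertex_dist_ex g p; exists b; rewrite lerDl coff_ge0.
Qed.

Lemma vertex_dist g h : cd (vx g) (vx h) = (wd g h)%:R.
Proof.
by have [b ->] := vertex_dist_ex g (vx h); rewrite cend_vertex coff_vertex addr0.
Qed.

Lemma vertex_cend_dist b p : cd p (vx (cend b p)) <= coff b p.
Proof.
apply: le_trans (cayley_dist_le b b p _) _.
by rewrite cend_vertex coff_vertex (word_dist_self gen_S) !addr0.
Qed.

Lemma cayley_dist_ge0 p q : 0 <= cd p q.
Proof. exact: (pseudo_ge0 cayley_dist_self cayley_dist_sym cayley_dist_tri). Qed.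

Let geo_ends := geodesic_ends cayley_dist_self cayley_dist_sym cayley_dist_tri.

(** * Geodesics in the realisation *)

Definition clamp (l t : R) : R := Num.max 0 (Num.min t l).

Lemma clamp_itv (b : bool) (t : R) : 0 <= clamp b%:R t <= b%:R.
Proof. by rewrite /clamp le_max lexx ge_max ge_min lexx orbT ler0n. Qed.

Lemma clamp_id (l t : R) : 0 <= t <= l -> clamp l t = t.
Proof. by case/andP=> t0 tl; rewrite /clamp min_l // max_r. Qed.

(** Curves are total functions, so every real parameter has to be forced into the range of
    positions. *)
Definition edge_point (u v : G) (uv : u = v \/ Defs.adjacent S u v) (t : R) : pt :=
  CayleyPoint uv (clamp_itv (u != v) t).

(** Recording the ends of the points of the curve is what later links realised geodesics to
    vertices. *)
Lemma segment_in_edge p q : same_edge false p q ->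
  exists2 c, geodesic_segment cd p q c & forall t b, cend b (c t) = cend b p.
Proof.
move=> pq; have uv := cayley_pointP p.
have Es : src q = src p by exact: (pq false).
have Et : tgt q = tgt p by exact: (pq true).
pose e t := edge_point uv t.
have eE s t : 0 <= s <= (src p != tgt p)%:R -> 0 <= t <= (src p != tgt p)%:R ->
    cd (e s) (e t) = `|s - t|.
  move=> hs ht; rewrite (@same_edge_dist false false) //=; last by case.
  by rewrite !clamp_id.
have p_in := pos_itv p; have q_in : 0 <= pos q <= (src p != tgt p)%:R.
  by have := pos_itv q; rewrite Es Et.
have ep : cd (e (pos p)) p = 0.
  by rewrite (@same_edge_dist false false) ?/= ?clamp_id ?subrr ?normr0 //; case.
have eq : cd (e (pos q)) q = 0.
  by rewrite (@same_edge_dist false false) ?/= ?clamp_id ?subrr ?normr0 //; case.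
have pqE : cd p q = `|pos p - pos q| by rewrite (@same_edge_dist false false).
have [le_pq|/ltW le_qp] := leP (pos p) (pos q).
  exists (fun t => e (pos p + t)); last by move=> t [].
  rewrite /geodesic_segment pqE distrC ger0_norm ?subr_ge0 //; split.
  - move=> s t /=; rewrite !in_itv /= => hs ht; rewrite eE; [|lra|lra].
    by congr `|_|; lra.
  - by rewrite addr0.
  - by rewrite addrC subrK.
exists (fun t => e (pos p - t)); last by move=> t [].
rewrite /geodesic_segment pqE ger0_norm ?subr_ge0 //; split.
- move=> s t /=; rewrite !in_itv /= => hs ht; rewrite eE; [|lra|lra].
  by rewrite distrC; congr `|_|; lra.
- by rewrite subr0.
- by rewrite subKr.
Qed.

Lemma segment_to_end b p : exists2 c, geodesic_segment cd p (vx (cend b p)) c &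
  forall t b', cend b' (c t) = cend b' p.
Proof.
pose q := edge_point (cayley_pointP p) (if b then (src p != tgt p)%:R else 0).
have pq : same_edge false p q by case.
have [c gc c_ends] := segment_in_edge pq; exists c => //.
apply: geo_ends gc; first exact: cayley_dist_self.
apply: le_anti; rewrite cayley_dist_ge0 andbT.
have -> : cend b p = cend b q by case: (b).
apply: le_trans (vertex_cend_dist b q) _.
by case: (b) @q {pq} => /=; rewrite /copos /= clamp_id ?lexx ?ler0n ?subrr.
Qed.

Lemma adjacent_segment u v : Defs.adjacent S u v ->
  exists2 c, geodesic_segment cd (vx u) (vx v) c &
    forall t b, cend b (c t) = if b then v else u.
Proof.
move=> uv; pose p := edge_point (or_intror uv) 0.
have [c gc c_ends] := segment_to_end true p; exists c.
  apply: geo_ends gc; last exact: cayley_dist_self.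
  apply: le_anti; rewrite cayley_dist_ge0 andbT.
  apply: le_trans (vertex_cend_dist false p) _.
  by rewrite /= clamp_id ?lexx ?ler0n.
by move=> t []; rewrite c_ends.
Qed.

(** Edges are appended one at a time. The clause on ends serves to turn a point on a side of a real
    triangle into a vertex of the discrete side. *)
Lemma discrete_geodesic_realization x y v : discrete_geodesic wd x y v ->
  exists2 c, geodesic_segment cd (vx x) (vx y) c &
    forall t b, 0 <= t <= (wd x y)%:R ->
      exists2 j, (j <= wd x y)%N & cend b (c t) = v j.
Proof.
suff real n : local_geodesic wd n n v ->
    exists2 c, geodesic_segment cd (vx (v 0%N)) (vx (v n)) c &
      forall t b, 0 <= t <= n%:R -> exists2 j, (j <= n)%N & cend b (c t) = v j.
  by case=> v0 vn /real; rewrite v0 vn.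
elim: n => [|n IH] gv.
  exists (fun=> vx (v 0%N)); last by move=> t b _; exists 0%N; case: b.
  by apply: (geodesic_const cayley_dist_self cayley_dist_sym cayley_dist_tri);
    exact: cayley_dist_self.
have [|c gc c_ends] := IH; first by move=> i j ij jn _; apply: gv; lia.
have vn : wd (v n) (v n.+1) = 1%N by rewrite gv; lia.
have v0n : wd (v 0%N) (v n) = n by rewrite gv; lia.
have v0n1 : wd (v 0%N) (v n.+1) = n.+1 by rewrite gv; lia.
have [e ge e_ends] := adjacent_segment (word_dist_eq1 gen_S vn).
exists (concat_path (cd (vx (v 0%N)) (vx (v n))) c e).
  apply: (geodesic_concat cayley_dist_self cayley_dist_sym cayley_dist_tri) => //.
  by rewrite !vertex_dist vn v0n v0n1 natr1.
move=> t b t_in; rewrite /concat_path vertex_dist v0n.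
case: ifP => [tn|_].
  have [|j jn ->] := c_ends t b; first by lra.
  by exists j => //; apply: leq_trans jn _; lia.
by rewrite e_ends; case: b; [exists n.+1 | exists n].
Qed.

(** On a common edge, a segment of it works, after reversing the description of [q] if necessary.
    Otherwise a shortest route through ends is made of three geodesics whose lengths add up to at
    most the distance. *)
Lemma cayley_geodesic_exists p q : exists c, geodesic_segment cd p q c.
Proof.
have concat := geodesic_concat cayley_dist_self cayley_dist_sym cayley_dist_tri.
have [[s pq]|[b [b' pqE]]] := cayley_dist_cases p q.
  case: s pq => [pq|/segment_in_edge[c gc _]]; last by exists c.
  have itv : 0 <= copos q <= (tgt q != src q)%:R.
    by have := pos_itv q; rewrite (eq_sym (tgt q)) /copos; lra.
  have qt : tgt q = src q \/ Defs.adjacent S (tgt q) (src q).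
    case: (cayley_pointP q) => [->|[qne lq]]; first by left.
    right; split; first exact/nesym.
    by have := letterV lq; rewrite invgM invgK.
  pose q' := CayleyPoint qt itv.
  have [|c gc _] := @segment_in_edge p q'.
    by move=> b; have := pq (~~ b); case: b.
  exists c; apply: geo_ends gc; first exact: cayley_dist_self.
  rewrite (@same_edge_dist true false) ?/= ?/copos /=; last by case.
  rewrite (eq_sym (tgt q)); apply/eqP; rewrite normr_eq0.
  by rewrite /copos; apply/eqP; lra.
have [c gc _] := segment_to_end b p; have [c' gc' _] := segment_to_end b' q.
have [v gv] := word_discrete_geodesic gen_S (cend b p) (cend b' q).
have [e ge _] := discrete_geodesic_realization gv.
have pb := vertex_cend_dist b p; have qb := vertex_cend_dist b' q.
have pbb := vertex_dist (cend b p) (cend b' q).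
have tri1 := cayley_dist_tri p (vx (cend b p)) q.
have tri2 := cayley_dist_tri (vx (cend b p)) (vx (cend b' q)) q.
have := geodesic_rev cayley_dist_sym gc'; rewrite -/cd => gq.
rewrite (cayley_dist_sym (vx (cend b' q)) q) in tri2.
eexists; apply: (concat _ _ _ _ _ gc (concat _ _ _ _ _ ge gq _)).
  by rewrite (cayley_dist_sym (vx (cend b' q)) q); lra.
by rewrite pqE; lra.
Qed.

Lemma geodesic_through x y u : between wd x y u ->
  exists2 c, geodesic_segment cd (vx x) (vx y) c & cd (c (wd x u)%:R) (vx u) = 0.
Proof.
move=> xyu.
have [v1 gv1] := word_discrete_geodesic gen_S x u.
have [v2 gv2] := word_discrete_geodesic gen_S u y.
have [c1 gc1 _] := discrete_geodesic_realization gv1.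
have [c2 gc2 _] := discrete_geodesic_realization gv2.
exists (concat_path (cd (vx x) (vx u)) c1 c2); last first.
  by rewrite -vertex_dist; exact: concat_path_middle gc1 gc2.
apply: (geodesic_concat cayley_dist_self cayley_dist_sym cayley_dist_tri) => //.
by rewrite !vertex_dist -natrD xyu.
Qed.

Variable delta : R.
Hypothesis hyp : hyperbolic cd delta.

Lemma delta_ge0 : 0 <= delta.
Proof.
exact: (hyperbolic_ge0 cayley_dist_self cayley_dist_sym cayley_dist_tri hyp (vx 1%g)).
Qed.

(** Some end of the edge carrying a point is no farther from the vertex [u] than the point itself,
    and that end is a vertex of the side. Distances of vertices being integers, [delta] can be
    replaced by its integer part. *)
Lemma vertex_slim : discrete_slim wd (Num.truncn delta).
Proof.
move=> x y z u q xyu gq.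
have [v gv] := word_discrete_geodesic gen_S z x.
have [Q gQ Q_ends] := discrete_geodesic_realization gq.
have [P gP P_ends] := discrete_geodesic_realization gv.
have [c gc cu] := geodesic_through xyu.
have u_le r : cd (c (wd x u)%:R) r <= delta ->
    exists b, (wd u (cend b r) <= Num.truncn delta)%N.
  have [b ur] := vertex_dist_le u r => le_delta; exists b.
  rewrite truncn_ge_nat ?delta_ge0 //; apply: le_trans ur _.
  apply: le_trans (cayley_dist_tri _ (c (wd x u)%:R) _) _.
  by rewrite cayley_dist_sym cu add0r.
have [|[s s_in /u_le[b ub]]|[s s_in /u_le[b ub]]] :=
    hyp gc gQ gP (t := (wd x u)%:R).
- by rewrite ler0n vertex_dist ler_nat -xyu leq_addr.
- left; rewrite vertex_dist in s_in; have [j jq E] := Q_ends s b s_in.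
  by exists j => //; rewrite -E.
right; rewrite vertex_dist in s_in; have [j jq E] := P_ends s b s_in.
exists (cend b (P s)) => //; rewrite E; exact: discrete_geodesic_between gv jq.
Qed.

End CayleyMetric.

(** * Axes and translation length *)

Lemma subadditive_nat_mul (R : realType) (a : nat -> R) (q p : nat) :
  (forall i j, a (i + j)%N <= a i + a j) -> a 0%N = 0 -> a (q * p)%N <= q%:R * a p.
Proof.
move=> sub a0; elim: q => [|q IH]; first by rewrite mul0n a0 mul0r.
by rewrite mulSn -natr1 mulrDl mul1r; have := sub p (q * p)%N; lra.
Qed.

(* Fekete: the limit is the infimum of [a n / n]. *)
Lemma subadditive_average_cvg (R : realType) (a : nat -> R) (kappa : R) :
    0 <= kappa -> (forall i j, a (i + j)%N <= a i + a j) -> a 0%N = 0 ->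
    (forall n, (0 < n)%N -> n%:R * kappa <= a n) ->
  exists2 l, kappa <= l & (fun n : nat => n%:R^-1 * a n) @ \oo --> l.
Proof.
move=> kappa0 sub a0 a_ge.
pose A := [set n%:R^-1 * a n | n in [set n : nat | (0 < n)%N]].
have A0 : A !=set0 by exists (1%:R^-1 * a 1%N), 1%N.
have lbA : lbound A kappa.
  move=> _ [n /= n0 <-]; rewrite ler_pdivlMl ?ltr0n //; exact: a_ge.
have infA n : (0 < n)%N -> inf A <= n%:R^-1 * a n.
  by move=> n0; apply: ge_inf; [exists kappa | exists n].
exists (inf A); first exact: lb_le_inf.
apply/cvgrPdist_le => e e0.
have [_ [p /= p0 <-] p_lt] := @inf_adherent _ A (e / 2) ltac:(lra)
  (conj A0 (ex_intro _ kappa lbA)).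
(* Bounds the contribution of the remainder in [n = (n %/ p) * p + n %% p], uniformly in [n]. *)
pose M := p%:R * `|a 1%N|.
have M0 : 0 <= M by rewrite mulr_ge0.
have pR : 0 < p%:R :> R by rewrite ltr0n.
near=> n.
have n_gt : M / (e / 2) < n%:R by near: n; exact: nbhs_infty_gtr.
have n0 : (0 < n)%N.
  by rewrite -(ltr0n R); apply: le_lt_trans n_gt; rewrite divr_ge0 //; lra.
have nR : 0 < n%:R :> R by rewrite ltr0n.
have an : a n <= (n %/ p)%:R * a p + M.
  rewrite {1}(divn_eq n p); apply: le_trans (sub _ _) _.
  apply: lerD; first exact: subadditive_nat_mul.
  have := subadditive_nat_mul (n %% p) 1 sub a0; rewrite muln1 => /le_trans; apply.
  apply: le_trans (ler_wpM2l (ler0n _ _) (ler_norm _)) _.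
  by apply: ler_wpM2r; rewrite ?normr_ge0 // ler_nat ltnW // ltn_mod.
have infA0 : 0 <= inf A + e / 2.
  by have := lb_le_inf A0 lbA; lra.
have ap : a p <= p%:R * (inf A + e / 2) by rewrite -ler_pdivrMl // ltW.
have qpn : (n %/ p)%:R * p%:R <= n%:R :> R by rewrite -natrM ler_nat leq_divM.
have := ler_wpM2r infA0 qpn; have := ler_wpM2l (ler0n R (n %/ p)) ap.
rewrite ltr_pdivrMr in n_gt; last by lra.
rewrite distrC ger0_norm ?subr_ge0 ?infA // lerBlDr ler_pdivrMl // mulrA.
rewrite !mulrDr; lra.
Unshelve. all: by end_near.
Qed.

Section Axis.
Context {R : realType} {G : groupType} (S : set G).
Hypothesis gen_S : generates S.
Local Notation wd := (word_dist S).
Local Notation pt := (cayley_point S R).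
Local Notation cd := (@cayley_dist G S R).
Local Notation vx := (vertex S R).
Local Notation act := (@cayley_act G S R).

Let dself := @cayley_dist_self R G S.
Let dsym := @cayley_dist_sym R G S gen_S.
Let dtri := @cayley_dist_tri R G S gen_S.

Lemma word_dist_expgM g n k : (wd 1 (g ^+ (n * k)) <= n * wd 1 (g ^+ k))%g%N.
Proof.
elim: n => [|n IH]; first by rewrite mul0n expg0 (word_dist_self gen_S).
rewrite !mulSn expgnDr; apply: leq_trans (word_dist_tri gen_S _ (g ^+ k)%g _) _.
by rewrite leq_add2l -[X in wd X _]mulg1 word_dist_mull.
Qed.

(** As [n <= |g^(n m)| <= m |g^n|], the averages [|g^n| / n] are at least [1 / m], which keeps their
    limit positive. *)
Lemma loxodromic_of_growth (g : G) (m : nat) : (0 < m)%N ->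
  (forall n, (n <= wd 1%g (g ^+ (n * m))%g)%N) -> loxodromic S R g.
Proof.
move=> m0 growth; pose a n : R := (wd 1%g (g ^+ n)%g)%:R.
have [||||l l_ge cvg_l] := @subadditive_average_cvg R a m%:R^-1.
- by rewrite invr_ge0.
- move=> i j; rewrite /a -natrD ler_nat expgnDr.
  apply: leq_trans (word_dist_tri gen_S _ (g ^+ i)%g _) _.
  by rewrite leq_add2l -[X in wd X _]mulg1 word_dist_mull.
- by rewrite /a expg0 (word_dist_self gen_S).
- move=> n n0; rewrite /a ler_pdivrMr ?ltr0n // -natrM ler_nat.
  by rewrite mulnC (leq_trans (growth n)) // mulnC word_dist_expgM.
exists l; first by apply: lt_le_trans l_ge; rewrite invr_gt0 ltr0n.
by under eq_fun do rewrite (vertex_dist gen_S).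
Qed.

(** Stated through distances, which avoids comparing the proofs stored in points. *)
Lemma cayley_act_mul g h p q : cd (act (g * h)%g p) q = cd (act g (act h p)) q.
Proof.
by rewrite /cayley_dist /through_ends /copos /= -!mulgA !(inj_eq (@mulgI G g)).
Qed.

Lemma cayley_act1 p q : cd (act 1%g p) q = cd p q.
Proof. by rewrite /cayley_dist /through_ends /copos /= !mul1g. Qed.

Lemma cayley_act_vertex g h p : cd (act g (vx h)) p = cd (vx (g * h)%g) p.
Proof. by []. Qed.

(** An isometry fixing the class of a ray moves the ray to an asymptotic one; the two halves of [c]
    give the bounds for [t >= 0] and [t <= 0]. *)
Lemma axis_displacement (g : G) (c : R -> pt) : axis cd (act g) c ->
  exists K, forall t, cd (act g (c t)) (c t) <= K.
Proof.
move=> [gc fixE].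
have fixed r : geodesic_ray cd r -> boundary_fixed cd (act g) (ray_class cd r) ->
    exists K, forall t, 0 <= t -> cd (act g (r t)) (r t) <= K.
  move=> gr [_ rE].
  have rr : ray_class cd r r by split=> //; exists 0 => t _; rewrite dself.
  have : ray_class cd r (act g \o r) by rewrite -{1}rE; exists r.
  by move=> [_ [K hK]]; exists K => t /hK; rewrite dsym.
have [||K1 hK1] := fixed c; first by move=> s t _ _; apply: gc.
  by rewrite fixE; left.
have [||K2 hK2] := fixed (fun t => c (- t)).
- by move=> s t _ _; rewrite gc // -opprD normrN.
- by rewrite fixE; right.
exists (Num.max K1 K2) => t; rewrite le_max.
have [t0|/ltW t0] := leP 0 t; first by rewrite hK1.
by have := hK2 (- t); rewrite opprK => -> //; rewrite ?orbT // oppr_ge0.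
Qed.

Lemma power_displacement (g : G) (c : R -> pt) (K : R) (n : nat) :
    (forall t, cd (act g (c t)) (c t) <= K) ->
  forall t, cd (act (g ^+ n)%g (c t)) (c t) <= n%:R * K.
Proof.
move=> hK t; elim: n => [|n IH].
  by rewrite mul0r expg0 cayley_act1 dself.
rewrite expgSr cayley_act_mul.
apply: le_trans (dtri _ (act (g ^+ n)%g (c t)) _) _.
by rewrite cayley_dist_act -natr1 mulrDl mul1r addrC lerD.
Qed.

Variable delta : R.
Hypothesis hyp : hyperbolic cd delta.

(* The points [g ^- n] and [g ^+ n] are close to the axis for all n, and 1 is
   close to every geodesic joining them. *)
Lemma axis_near (g : G) (A : nat) (c : R -> pt) :
    axis cd (act g) c ->
    (forall M, exists2 n, (M <= wd 1 (g ^+ n))%g%N &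
      exists2 u, between wd (g ^- n)%g (g ^+ n)%g u & (wd 1 u <= A)%g%N) ->
  exists t, cd (c t) (vx 1%g) <= 2 * delta + A%:R.
Proof.
move=> ax far; have [K hK] := axis_displacement ax; have [gc _] := ax.
have geoX := cayley_geodesic_exists gen_S (R := R).
(* [C] is the same for all powers of [g]. *)
pose rho := cd (vx 1%g) (c 0); pose C := rho + 2 * delta.
have close h K' : (forall t, cd (act h (c t)) (c t) <= K') ->
    exists s, cd (vx h) (c s) <= C.
  move=> hK'; have [s] := orbit_close_geodesic dself dsym dtri geoX hyp
    gc (cayley_dist_act h) hK' (lexx rho).
  by rewrite cayley_act_vertex mulg1; exists s.
(* So large that [u], which is within [A] of 1, stays farther than [2 * delta + C] from both
   ends. *)
have [n n_far [u xyu uA]] := far (Num.truncn (2 * delta + C + A%:R)).+1.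
have hKn := power_displacement n hK.
have hKn' t : cd (act (g ^- n)%g (c t)) (c t) <= n%:R * K.
  rewrite -(cayley_dist_act (g ^+ n)%g) -cayley_act_mul mulgV cayley_act1 dsym.
  exact: hKn.
have [s1 x_c] := close _ _ hKn'; have [s2 y_c] := close _ _ hKn.
have [p gp pu] := geodesic_through (R := R) gen_S xyu.
have t_in : 0 <= ((wd (g ^- n)%g u)%:R : R) <= cd (vx (g ^- n)%g) (vx (g ^+ n)%g).
  by apply/andP; split; rewrite ?ler0n // vertex_dist // ler_nat -xyu leq_addr.
have p_near v : cd (p (wd (g ^- n)%g u)%:R) (vx v) = (wd u v)%:R.
  by rewrite (pseudo_eq0 dsym dtri pu (dself (vx v))) vertex_dist.
have u_far v : wd 1%g v = wd 1%g (g ^+ n)%g -> 2 * delta + C < (wd u v)%:R.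
  move=> vE; have := word_dist_tri gen_S 1%g u v.
  have lt_n : 2 * delta + C + A%:R < (wd 1%g (g ^+ n)%g)%:R.
    by apply: lt_le_trans (truncnS_gt _) _; rewrite ler_nat.
  by move: uA lt_n; rewrite -vE -!(ler_nat R) natrD; lra.
have [||s ps] := far_geodesic_close dself dsym dtri geoX hyp gc gp t_in x_c y_c.
- rewrite p_near u_far // -(word_dist_mull _ (g ^+ n)%g) mulg1 mulgV.
  exact: word_dist_sym.
- by rewrite p_near u_far.
exists s; apply: le_trans (dtri _ (p (wd (g ^- n)%g u)%:R) _) _.
apply: lerD; first by rewrite dsym.
by rewrite p_near (word_dist_sym gen_S) ler_nat.
Qed.
End Axis.

(** * Local geodesic words *)

(** If [v] starts no later than [s], it ends no later than [s]; otherwise it lies in [s ++ b]. *)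
Lemma infix_overlap (T : eqType) (v a s b : seq T) : (size v <= size s)%N ->
  infix v (a ++ s ++ b) -> infix v (a ++ s) || infix v (s ++ b).
Proof.
move=> vs /infixP[l [r E]]; have [la|al] := leqP (size l) (size a).
  have := congr1 (take (size (a ++ s))) E; rewrite catA take_size_cat // => ->.
  rewrite catA take_cat size_cat ltnNge size_cat leq_add //=.
  by rewrite -catA infix_infix.
have := congr1 (drop (size a)) E; rewrite drop_size_cat // => ->.
by rewrite drop_cat al infix_infix orbT.
Qed.

Lemma finite_uniform (T : eqType) (A : set T) (Q : T -> nat -> Prop) :
    finite_set A -> (forall x m n, (m <= n)%N -> Q x m -> Q x n) ->
    (forall x, A x -> exists n, Q x n) ->
  exists n, forall x, A x -> Q x n.
Proof.
move=> /finite_seqP[s ->] mono; elim: s => [|x s IH] ex; first by exists 0%N.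
have [|n hn] := IH; first by move=> y /= ys; apply: ex; rewrite /= inE ys orbT.
have [|k hk] := ex x; first by rewrite /= inE eqxx.
exists (maxn n k) => y /=; rewrite inE => /predU1P[->|ys].
  exact: mono (leq_maxr _ _) hk.
by apply: mono (leq_maxl _ _) (hn y ys).
Qed.

Section Language.
Context {R : realType} {G : groupType} (S : set G).
Hypothesis gen_S : generates S.
Local Notation wd := (word_dist S).
Local Notation norm := (word_norm S).

(** The language with an integer scale, so that [N = 2] is available even when [10 * delta < 2]. *)
Definition locally_geodesic_word (N : nat) (w : seq G) : Prop :=
  word S w /\ forall v, infix v w -> (size v <= N)%N -> geodesic_word S v.
Local Notation lg := locally_geodesic_word.

Lemma local_geodesic_wordsE (delta : R) (w : seq G) : 0 <= delta ->
  local_geodesic_words S delta w <-> lg (Num.truncn (10 * delta)) w.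
Proof.
move=> d0; have d10 : 0 <= 10 * delta by lra.
by split=> -[ww gw]; split => // v vw; have := gw v vw; rewrite truncn_ge_nat.
Qed.

Lemma locally_geodesic_infix N v w : infix v w -> lg N w -> lg N v.
Proof.
move=> vw [ww gw]; split; first exact: word_infix vw ww.
by move=> u uv; apply: gw; apply: infix_trans uv vw.
Qed.

Lemma geodesic_locally_geodesic N w : word S w -> geodesic_word S w -> lg N w.
Proof. by move=> ww gw; split=> // v vw _; exact: geodesic_infix vw ww gw. Qed.

(** A window of length at most [N] cannot meet both [a] and [b]. *)
Lemma locally_geodesic_glue N a s b : (N <= size s)%N ->
  lg N (a ++ s) -> lg N (s ++ b) -> lg N (a ++ s ++ b).
Proof.
move=> Ns [was gas] [wsb gsb]; split.
  by apply/word_cat; split => //; case/word_cat: was.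
move=> v /infix_overlap vI vN.
by case/orP: (vI (leq_trans vN Ns)) => [/gas|/gsb]; apply.
Qed.

(** The vertices read along the infinite word [u u u ...] from the neutral element. *)
Definition periodic_path (u : seq G) (i : nat) : G :=
  (\prod_(0 <= k < i) nth 1 u (k %% size u))%g.

Lemma periodic_path_shift u n i :
  periodic_path u (n * size u + i) = (word_value u ^+ n * periodic_path u i)%g.
Proof.
elim: n => [|n IH]; first by rewrite mul0n expg0 mul1g.
rewrite expgS -mulgA -IH mulSn -addnA /periodic_path.
rewrite (@big_cat_nat _ _ _ (size u)) ?leq_addr //=; congr (_ * _)%g.
  rewrite /word_value (big_nth 1%g); apply: eq_big_nat => k /andP[_ ku].
  by rewrite modn_small.
rewrite -{1}[size u]add0n big_addn addKn; apply: eq_bigr => k _.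
by rewrite modnDr.
Qed.

Lemma periodic_path_power u n :
  periodic_path u (n * size u) = (word_value u ^+ n)%g.
Proof.
by rewrite -[X in periodic_path _ X]addn0 periodic_path_shift /periodic_path
  big_nil ?big_geq ?mulg1.
Qed.

Lemma periodic_path_prefix w w2 i : (i <= size (w ++ w2) + size w)%N ->
  periodic_path (w ++ w2) i = word_value (take i (w ++ w2 ++ w)).
Proof.
move=> i_le; rewrite catA; set u := w ++ w2 in i_le *.
rewrite /word_value (big_nth 1%g) size_takel; last by rewrite size_cat.
apply: eq_big_nat => k /andP[_ ki]; rewrite nth_take // [RHS]nth_cat.
case: ltnP => ku; first by rewrite modn_small.
have wu : (size w <= size u)%N by rewrite size_cat leq_addr.
have kw : (k - size u < size w)%N by rewrite ltn_subLR // (leq_trans ki).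
rewrite -{1}(subnK ku) modnDr modn_small; last exact: leq_trans wu.
by rewrite /u nth_cat kw.
Qed.

(* A window of length N <= |w| + 1 in the infinite word (w w2)^oo is a translate
   of one in w w2 w. *)
Lemma periodic_path_local_geodesic N w w2 K :
    (0 < size w)%N -> (N <= (size w).+1)%N -> lg N (w ++ w2 ++ w) ->
  local_geodesic wd N K (periodic_path (w ++ w2)).
Proof.
move=> w0 Nw [_ gw] i j ij _ jN.
have U0 : (0 < size (w ++ w2))%N by rewrite size_cat ltn_addr.
have rU := ltn_pmod i U0; have iE := divn_eq i (size (w ++ w2)).
set q := (_ %/ _)%N in iE; set r := (_ %% _)%N in iE rU.
have jE : j = (q * size (w ++ w2) + (r + (j - i)))%N by lia.
rewrite [in X in wd X _]iE [in X in wd _ X]jE !periodic_path_shift.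
(* With [u = w ++ w2], from [r <= |u| - 1] and [j - i <= N <= |w| + 1] the window ends by
   [|u| + |w|], the length of [w w2 w]. *)
rewrite word_dist_mull !periodic_path_prefix; [|lia|lia].
rewrite -[X in wd X _]mul1g -[X in wd _ X]mul1g word_dist_prefixes ?leq_addr //.
have sz : size (drop r (take (r + (j - i)) (w ++ w2 ++ w))) = (j - i)%N.
  by rewrite size_drop size_takel ?addKn // catA size_cat; lia.
rewrite -gw ?sz //; last by lia.
exact: infix_trans (infix_drop _ _) (infix_take _ _).
Qed.

(** * Connecting words of bounded length *)

Lemma finite_letter : finite_set S -> finite_set (letter S).
Proof.
move=> fS; apply: sub_finite_set (_ : _ `<=` S `|` (fun x => x^-1)%g @` S) _.
  by move=> s [|sV]; [left | right; exists (s^-1)%g => //; rewrite invgK].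
by rewrite finite_setU; split => //; exact: finite_image.
Qed.

Lemma words_uniform (n : nat) (Q : seq G -> nat -> Prop) : finite_set S ->
    (forall w k l, (k <= l)%N -> Q w k -> Q w l) ->
    (forall w, word S w -> size w = n -> exists k, Q w k) ->
  exists k, forall w, word S w -> size w = n -> Q w k.
Proof.
move=> fS; elim: n Q => [|n IH] Q mono ex.
  have [//|//|k hk] := ex [::]; exists k => w _ /size0nil ->; exact: hk.
have [||k hk] := @finite_uniform _ (letter S)
    (fun s k => forall w, word S w -> size w = n -> Q (s :: w) k) (finite_letter fS).
- by move=> s k l kl h w ww wn; exact: (mono _ _ _ kl (h w ww wn)).
- move=> s ls; apply: IH => [w|w ww wn]; first exact: mono.
  by apply: ex => [t|]; rewrite ?inE /= ?wn // => /predU1P[->|/ww].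
exists k => -[//|s w] ww [wn]; apply: hk => //; first by apply: ww; rewrite inE eqxx.
by move=> t tw; apply: ww; rewrite inE tw orbT.
Qed.

(** There are finitely many pairs of words of length [N]; those not locally geodesic satisfy [Q]
    vacuously. *)
Lemma uniform_connecting (N : nat) : finite_set S ->
    (forall w1 w3, lg N w1 -> lg N w3 -> exists w2, lg N (w1 ++ w2 ++ w3)) ->
  exists D, forall s p, lg N s -> lg N p -> size s = N -> size p = N ->
    exists2 w2, lg N (s ++ w2 ++ p) & (size w2 <= D)%N.
Proof.
move=> fS conn.
pose Q s p k := lg N s -> lg N p -> exists2 w2, lg N (s ++ w2 ++ p) & (size w2 <= k)%N.
have mono s p k l : (k <= l)%N -> Q s p k -> Q s p l.
  by move=> kl h ls lp; have [w2 ? ?] := h ls lp; exists w2 => //; apply: leq_trans kl.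
have [||D hD] := @words_uniform N
  (fun s k => forall p, word S p -> size p = N -> Q s p k) fS.
- by move=> s k l kl h p wp pN; exact: (mono _ _ _ _ kl (h p wp pN)).
- move=> s _ _; apply: (@words_uniform N (Q s) fS (mono s)) => p _ _.
  have [[ls lp]|nlg] := pselect (lg N s /\ lg N p).
    by have [w2 ?] := conn s p ls lp; exists (size w2) => _ _; exists w2.
  by exists 0%N => ls lp; case: nlg.
by exists D => s p ls lp sN pN; apply: hD => //; [case: ls | case: lp].
Qed.

(** A word that connects the last [N] letters of [w] to its first [N] letters also connects two full
    copies of [w], by gluing on either side. *)
Lemma bounded_connecting (N : nat) : finite_set S ->
    (forall w1 w3, lg N w1 -> lg N w3 -> exists w2, lg N (w1 ++ w2 ++ w3)) ->
  exists D, forall w, lg N w -> (N <= size w)%N ->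
    exists2 w2, lg N (w ++ w2 ++ w) & (size w2 <= D)%N.
Proof.
move=> fS /(uniform_connecting fS)[D hD]; exists D => w lw Nw.
pose a := take (size w - N) w; pose s := drop (size w - N) w.
pose p := take N w; pose b := drop N w.
have wE : w = a ++ s by rewrite cat_take_drop.
have wE' : w = p ++ b by rewrite cat_take_drop.
have sN : size s = N by rewrite size_drop subKn.
have pN : size p = N by rewrite size_takel.
have [||//|//|w2 lspw w2D] := hD s p.
- by apply: locally_geodesic_infix lw; apply: infix_drop.
- by apply: locally_geodesic_infix lw; apply: infix_take.
exists w2 => //; rewrite {1}wE wE' -catA.
apply: locally_geodesic_glue; rewrite ?sN -?wE //.
by rewrite catA; apply: locally_geodesic_glue; rewrite ?pN -?wE' // -catA.
Qed.

End Language.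

(** * Small delta: reduced words *)

Section Tree.
Context {R : realType} {G : groupType} (S : set G).
Hypothesis gen_S : generates S.
Local Notation wd := (word_dist S).
Local Notation norm := (word_norm S).
Local Notation pt := (cayley_point S R).
Local Notation cd := (@cayley_dist G S R).
Local Notation vx := (vertex S R).
Local Notation lg := (locally_geodesic_word S).

(** The midpoint is 1/2 away from both ends of its edge, and a path to a point of another edge
    leaves through one of them. *)
Lemma adjacent_midpoint u v c (p := c (2^-1)) : Defs.adjacent S u v ->
    geodesic_segment cd (vx u) (vx v) c ->
  forall q, ~ (exists sigma, same_edge sigma p q) ->
    (forall b, cend b p = if b then v else u) -> 2^-1 <= cd p q.
Proof.
move=> uv gc q npq p_ends.
have uvE : wd u v = 1%N.
  by rewrite (word_dist_adjacent gen_S (or_intror uv)); case: uv => /eqP->.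
have half_in : 0 <= (2^-1 : R) <= cd (vx u) (vx v).
  by rewrite (vertex_dist gen_S) uvE; apply/andP; split; lra.
have pu := geodesic_dist_source (@cayley_dist_self R G S) (cayley_dist_sym gen_S)
  (cayley_dist_tri gen_S) gc half_in.
have pv := geodesic_dist_target (@cayley_dist_self R G S) (cayley_dist_sym gen_S)
  (cayley_dist_tri gen_S) gc half_in.
rewrite (vertex_dist gen_S) uvE in pv.
have off b : 2^-1 <= coff b p.
  apply: le_trans (vertex_cend_dist gen_S b p); rewrite p_ends.
  case: b; first by rewrite pv; lra.
  by rewrite (cayley_dist_sym gen_S) pu.
have [//|[b [b' ->]]] := cayley_dist_cases p q.
have := off b; have := coff_ge0 b' q.
by have := ler0n R (wd (cend b p) (cend b' q)); lra.
Qed.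

Variable delta : R.
Hypothesis hyp : hyperbolic cd delta.

(* The midpoint of a side of a triangle of edges is at distance 1/2 from the
   other two sides. *)
Lemma no_triangle s t : delta < 2^-1 -> letter S s -> letter S t ->
  (s <> 1 -> t <> 1 -> s * t <> 1 -> norm (s * t) = 2%N)%g.
Proof.
move=> d_lt ls lt s1 t1 st1.
have ns := word_norm_letter gen_S ls s1; have nt := word_norm_letter gen_S lt t1.
have : (norm (s * t)%g <= 2)%N by rewrite -[2%N]/(1 + 1)%N -{1}ns -nt word_normM.
rewrite leq_eqVlt ltnS => /predU1P[//|le1]; exfalso.
have nst : norm (s * t)%g = 1%N.
  by apply/eqP; rewrite eqn_leq le1 lt0n; apply/eqP => /(word_norm_eq0 gen_S).
have adj_1s : Defs.adjacent S 1%g s.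
  by apply: word_dist_eq1; rewrite // word_dist_1.
have adj_sst : Defs.adjacent S s (s * t)%g.
  by apply: word_dist_eq1; rewrite // /word_dist mulKg.
have adj_st1 : Defs.adjacent S (s * t)%g 1%g.
  by apply: word_dist_eq1; rewrite // (word_dist_sym gen_S) word_dist_1.
have [p gp p_ends] := adjacent_segment (R := R) gen_S adj_1s.
have [q gq q_ends] := adjacent_segment (R := R) gen_S adj_sst.
have [r gr r_ends] := adjacent_segment (R := R) gen_S adj_st1.
have mid_far := adjacent_midpoint adj_1s gp.
have st_s : (s * t)%g <> s.
  by move=> E; apply: t1; apply: (@mulgI _ s); rewrite E mulg1.
have [|[x _]|[x _]] := hyp gp gq gr (t := 2^-1).
- by rewrite (vertex_dist gen_S) word_dist_1 // ns; apply/andP; split; lra.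
- have := mid_far (q x); suff ne : ~ exists sigma, same_edge sigma (p 2^-1) (q x).
    by move=> /(_ ne (p_ends _)); lra.
  move=> [sigma E]; have := E (~~ sigma).
  have := E sigma; rewrite !q_ends !p_ends addbb addNb addbb /=.
  by case: sigma {E} => // E1 /s1.
have := mid_far (r x); suff ne : ~ exists sigma, same_edge sigma (p 2^-1) (r x).
  by move=> /(_ ne (p_ends _)); lra.
move=> [sigma E]; have := E (~~ sigma).
have := E sigma; rewrite !r_ends !p_ends addbb addNb addbb /=.
by case: sigma {E} => // /esym.
Qed.

(** [S] may contain the neutral element, hence the exclusion. *)
Definition nontrivial_letters (w : seq G) : Prop :=
  forall s, s \in w -> letter S s /\ s <> 1%g.

Definition reduced (w : seq G) : Prop :=
  nontrivial_letters w /\ sorted (fun s t => (s * t)%g != 1%g) w.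

Lemma reduced_locally_geodesic w : delta < 2^-1 -> reduced w -> lg 2 w.
Proof.
move=> d_lt [lw rw]; split=> [s /lw[]//|v vw].
have lv s : s \in v -> letter S s /\ s <> 1%g by move=> /(mem_infix vw)/lw.
have := infix_sorted vw rw; rewrite /geodesic_word /word_value.
case: v lv {vw} => [|s [|t [|//]]] lv /=.
- by rewrite big_nil word_norm1.
- have [ls s1] := lv s (mem_head _ _).
  by rewrite big_seq1 (word_norm_letter gen_S ls).
rewrite andbT => /eqP st _; rewrite big_cons big_seq1.
have [ls s1] := lv s (mem_head _ _).
by have [|lt t1] := lv t; [rewrite !inE eqxx orbT | rewrite (no_triangle d_lt)].
Qed.

Lemma geodesic_reduced w : word S w -> geodesic_word S w -> reduced w.
Proof.
move=> ww gw; split=> [s sw|].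
  split; first exact: ww.
  move=> s1; have := @geodesic_infix _ _ gen_S [:: s] w.
  rewrite infix1s => /(_ sw ww gw); rewrite /geodesic_word /word_value big_seq1 s1.
  by rewrite word_norm1.
apply/(sortedP 1%g) => i iw; apply/eqP => st.
have stE : take 2 (drop i w) = [:: nth 1%g w i; nth 1%g w i.+1].
  by rewrite (drop_nth 1%g) ?(ltnW iw) // (drop_nth 1%g) //= take0.
have := infix_trans (infix_take (drop i w) 2) (infix_drop _ _); rewrite stE.
move=> /(geodesic_infix gen_S)/(_ ww gw); rewrite /geodesic_word /word_value big_cons.
by rewrite big_seq1 st word_norm1.
Qed.

Hypothesis infinite_G : infinite_set [set: G].

(** Otherwise all values of words would lie in the subgroup [{1, x}], which is finite. *)
Lemma exists_other_letter x : (x = 1 \/ x * x = 1)%g ->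
  exists s, letter S s /\ (s <> 1 /\ s <> x)%g.
Proof.
move=> x2; apply: contrapT => no; apply: infinite_G.
apply: (@sub_finite_set _ _ [set 1%g; x]); last exact: finite_set2.
move=> g _; have [w ww <-] := gen_S g; elim: w ww => [|s w IH] ww.
  by left; rewrite /word_value big_nil.
rewrite /word_value big_cons -/(word_value w).
have s1x : s = 1%g \/ s = x.
  have [->|/eqP s1] := eqVneq s 1%g; first by left.
  have [->|/eqP sx] := eqVneq s x; first by right.
  by case: no; exists s; split => //; apply: ww; rewrite mem_head.
have {}IH : [set 1%g; x] (word_value w).
  by apply: IH => t tw; apply: ww; rewrite inE tw orbT.
case: s1x => ->; first by rewrite mul1g.
case: IH => ->; first by right; rewrite mulg1.
by case: x2 => ->; [right; rewrite mulg1 | left].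
Qed.

Lemma reduced_cat_self w : reduced w -> w <> [::] ->
  exists2 w2, reduced (w ++ w2 ++ w) & (size w2 <= 1)%N.
Proof.
case: w => // x w [lw /= rw] _; set y := last x w.
have [xl x1] := lw x (mem_head _ _).
have [yx|yx] := boolP ((y * x)%g != 1%g).
  exists [::] => //; split=> [s h|].
    by apply: lw; move: h; rewrite !(inE, mem_cat); case: (s == x); case: (s \in w).
  by rewrite /= cat_path rw /= -/y yx.
have {}yx : y = (x^-1)%g by move/negPn: yx; rewrite mulg_eq1 => /eqP.
(* [z] must cancel neither with [y = x^-1] before it nor with [x] after it. *)
have [z [zl [z1 [zx zV]]]] :
    exists z, letter S z /\ (z <> 1 /\ (z <> x /\ z <> x^-1))%g.
  apply: contrapT => no.
  have x_or z : letter S z -> z <> 1%g -> z = x \/ z = (x^-1)%g.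
    move=> zl z1; apply: contrapT => zn; apply: no; exists z.
    by split=> //; split=> //; split=> E; apply: zn; [left | right].
  (* If every nontrivial letter were [x] or [x^-1], each letter of the reduced word would repeat the
     preceding one; then [y = x], and [x * x = 1]. *)
  have yx' : y = x.
    have : forall t, t \in w -> letter S t /\ t <> 1%g.
      by move=> t tw; apply: lw; rewrite inE tw orbT.
    rewrite /y; elim: (w) rw => //= t v IH /andP[xt pv] lv.
    have [tl t1] := lv t (mem_head _ _).
    have tx : t = x by case: (x_or t tl t1) xt => [//|->]; rewrite mulgV eqxx.
    rewrite tx IH -?{1}tx // => z zv; apply: lv.
    by rewrite inE zv orbT.
  have [|z [zl [z1 zx]]] := @exists_other_letter x.
    by right; rewrite -{1}yx' yx mulVg.
  by case: (x_or z zl z1) => // zE; apply: zx; rewrite zE -yx yx'.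
exists [:: z] => //; split=> [s h|].
  have [->//|sz] := eqVneq s z; apply: lw; move: h.
  by rewrite !(inE, mem_cat) (negPf sz); case: (s == x); case: (s \in w).
rewrite /= cat_path rw /= -/y rw andbT yx !mulg_eq1 (inj_eq (@invg_inj G)).
rewrite eq_sym; apply/andP; split; exact/eqP.
Qed.

End Tree.

(** * Periodic local geodesics *)

Section Periodic.
Context {R : realType} {G : groupType} (S : set G) (delta : R).
Hypothesis gen_S : generates S.
Hypothesis hyp : hyperbolic (@cayley_dist G S R) delta.
Local Notation wd := (word_dist S).
Local Notation cd := (@cayley_dist G S R).
Local Notation vx := (vertex S R).
Local Notation lg := (locally_geodesic_word S).
Local Notation Delta := (Num.truncn delta).
Variables (N m : nat).
Hypothesis mN : (m + m <= N)%N.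
Hypothesis m_gt : (4 * Delta < m)%N.

Let wself := word_dist_self gen_S.
Let wsym := word_dist_sym gen_S.
Let wtri := word_dist_tri gen_S.
Let wgeo := word_discrete_geodesic gen_S.
Let wslim := vertex_slim gen_S hyp.

Lemma word_value_loxodromic w w2 :
    (0 < size w)%N -> (N <= (size w).+1)%N -> lg N (w ++ w2 ++ w) ->
  loxodromic S R (word_value (w ++ w2)) /\
  forall c, axis cd (cayley_act (word_value (w ++ w2))) c ->
    exists t, cd (c t) (vx 1%g) <= 2 * delta + (2 * Delta)%:R.
Proof.
move=> w0 Nw lw; set u := w ++ w2; set g := word_value u.
have u0 : (0 < size u)%N by rewrite size_cat ltn_addr.
have lc K := periodic_path_local_geodesic (K := K) w0 Nw lw.
have c0 : periodic_path u 0 = 1%g by rewrite /periodic_path big_geq.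
(* The index [n * m * size u] is read as [(n * size u) * m], and [size u >= 1]. *)
have growth n : (n <= wd 1 (g ^+ (n * m)))%g%N.
  rewrite -periodic_path_power -c0 mulnAC.
  apply: leq_trans (local_geodesic_lower_bound wself wsym wtri wgeo wslim mN m_gt _ lc).
  exact: leq_pmulr.
have m0 : (0 < m)%N by apply: leq_ltn_trans m_gt.
split; first exact: (loxodromic_of_growth gen_S m0 growth).
move=> c ax; apply: (axis_near gen_S hyp ax) => M.
(* By [growth], this power is at distance at least [M] from 1. *)
exists (M * m)%N => //; move: (M * m)%N => n.
have [v gv] := wgeo (g ^- n)%g (g ^+ n)%g.
have d2n : wd (g ^- n)%g (g ^+ n)%g = wd 1%g (g ^+ (n + n))%g.
  by rewrite -(word_dist_mull _ (g ^+ n)%g) mulgV expgnDr.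
(* The periodic path starts at 1, so the geodesic from [g^-n] to [g^n] is translated by [g^n]; the
   vertex 1 becomes [g^n], at index [n * size u]. *)
have gc : discrete_geodesic wd (periodic_path u 0)
    (periodic_path u ((n + n) * size u)) (fun i => g ^+ n * v i)%g.
  rewrite c0 periodic_path_power -/g; case: gv => v0 vn gv; split.
  - by rewrite v0 mulgV.
  - by rewrite -d2n vn expgnDr.
  - by move=> i j ij; rewrite -d2n => jn _; rewrite word_dist_mull gv; lia.
have [|j] := local_geodesic_close wself wsym wtri wgeo wslim mN m_gt
  (k := (n * size u)%N) (lc _) gc; first by rewrite leq_pmul2r // leq_addr.
rewrite c0 !periodic_path_power -/g -d2n => jn.
rewrite -[X in wd X _]mulg1 word_dist_mull => vj.
by exists (v j) => //; apply: discrete_geodesic_between gv jn.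
Qed.

End Periodic.

(** * A periodic local geodesic near every far element *)

Section Main.
Context {R : realType} {G : groupType} (S : set G) (delta : R).
Hypothesis infinite_G : infinite_set [set: G].
Hypothesis finite_S : finite_set S.
Hypothesis gen_S : generates S.
Hypothesis hyp : hyperbolic (@cayley_dist G S R) delta.
Hypothesis connecting : forall w1 w3 : seq G,
  local_geodesic_words S delta w1 -> local_geodesic_words S delta w3 ->
  exists2 w2 : seq G, local_geodesic_words S delta w2 &
    local_geodesic_words S delta (w1 ++ w2 ++ w3).
Local Notation wd := (word_dist S).
Local Notation lg := (locally_geodesic_word S).

Lemma word_dist_word_value_cat w w2 : word S w2 ->
  (wd (word_value w) (word_value (w ++ w2)) <= size w2)%N.
Proof.
by move=> ww2; rewrite word_value_cat /word_dist mulKg word_norm_le.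
Qed.

Lemma exists_periodic_words : exists N m D : nat,
  [/\ (m + m <= N)%N, (4 * Num.truncn delta < m)%N &
    forall g, 10 * delta <= (wd 1%g g)%:R -> exists w w2,
      [/\ (0 < size w)%N, (N <= (size w).+1)%N, lg N (w ++ w2 ++ w) &
        (wd g (word_value (w ++ w2)) <= D)%N]].
Proof.
have d0 := delta_ge0 gen_S hyp; have d10 : 0 <= 10 * delta by lra.
have [N2|N2] := leqP 2 (Num.truncn (10 * delta)).
  set N := Num.truncn _ in N2.
  have [|D hD] := @bounded_connecting _ _ N finite_S.
    move=> w1 w3 /(local_geodesic_wordsE _ _ d0) l1 /(local_geodesic_wordsE _ _ d0) l3.
    have [w2 _ /(local_geodesic_wordsE _ _ d0)] := connecting l1 l3.
    by exists w2.
  have N10 : (10 * Num.truncn delta <= N)%N.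
    by rewrite truncn_ge_nat // natrM ler_wpM2l // truncn_le.
  (* [N >= 10 * Delta] gives [N./2 > 4 * Delta] when [Delta > 0], and [N >= 2] does when
     [Delta = 0]. *)
  exists N, N./2, D; split; [lia | | move=> g g_far].
    by move: N2 N10; move: (Num.truncn delta) (N) => a n; lia.
  have [w [ww wg gw]] := geodesic_word_exists gen_S g.
  (* The distance hypothesis on [g] makes [w] long enough to have [N] first and [N] last letters. *)
  have Nw : (N <= size w)%N.
    rewrite gw wg -word_dist_1 -(ler_nat R); apply: le_trans g_far.
    by rewrite truncn_le.
  have [w2 lw w2D] := hD w (geodesic_locally_geodesic gen_S N ww gw) Nw.
  exists w, w2; split => //; [lia | lia |].
  rewrite -{1}wg; apply: leq_trans w2D; apply: word_dist_word_value_cat => //.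
  by case: lw => /word_cat[_ /word_cat[]].
rewrite truncn_lt_nat // in N2.
have d_lt : delta < 2^-1 by lra.
have D0 : Num.truncn delta = 0%N.
  by apply/eqP; rewrite -leqn0 -ltnS truncn_lt_nat //; lra.
(* The final 2 allows one letter to replace an empty word when [g = 1], and one for [w2]. A single
   letter is long enough for [N = 2]. *)
exists 2%N, 1%N, 2%N; split=> [//||g _]; first by rewrite D0.
have [w [rw wn0 gw]] : exists w, [/\ reduced S w, w <> [::] &
    (wd g (word_value w) <= 1)%N].
  have [w [ww wg gw]] := geodesic_word_exists gen_S g.
  have [w0|/eqP w0] := eqVneq w [::]; last first.
    by exists w; rewrite wg word_dist_self //; split=> //; exact: geodesic_reduced.
  have [s [ls [s1 _]]] := exists_other_letter gen_S infinite_G (or_introl (erefl 1%g)).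
  exists [:: s]; split => //; first by split => // t; rewrite inE => /eqP->.
  rewrite -wg w0 {1}/word_value big_nil word_dist_1 /word_value big_seq1.
  by rewrite word_norm_letter.
have [w2 rww w21] := reduced_cat_self gen_S infinite_G rw wn0.
have lw := reduced_locally_geodesic gen_S hyp d_lt rww.
have sw : (0 < size w)%N by case: (w) wn0.
exists w, w2; split => //; apply: leq_trans (word_dist_tri gen_S _ (word_value w) _) _.
apply: (leq_add gw (leq_trans _ w21)); apply: word_dist_word_value_cat.
by case: lw => /word_cat[_ /word_cat[]].
Qed.

End Main.

Unset Implicit Arguments.

Theorem proposition4p2 (R : realType) (G : groupType) (S : set G) (delta : R)
    (infinite_G : infinite_set [set: G])
    (finite_S : finite_set S)
    (generates_S : generates S)
    (hyperbolic_X : hyperbolic (@cayley_dist G S R) delta)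
    (connecting : forall w1 w3 : seq G,
       local_geodesic_words S delta w1 -> local_geodesic_words S delta w3 ->
       exists2 w2 : seq G, local_geodesic_words S delta w2 &
         local_geodesic_words S delta (w1 ++ w2 ++ w3)) :
  exists D Rad : R, forall g : G,
    10 * delta <= cayley_dist (vertex S R 1%g) (vertex S R g) ->
    exists g' : G,
      [/\ cayley_dist (vertex S R g) (vertex S R g') <= D,
          loxodromic S R g' &
          forall c : R -> cayley_point S R,
            axis (@cayley_dist G S R) (cayley_act g') c ->
            exists t : R, cayley_dist (c t) (vertex S R 1%g) <= Rad].
Proof.
have [N [m [D [mN m_gt periodic]]]] :=
  exists_periodic_words infinite_G finite_S generates_S hyperbolic_X connecting.
exists D%:R, (2 * delta + (2 * Num.truncn delta)%:R) => g.
rewrite vertex_dist // => /periodic[w [w2 [w0 Nw lw gD]]].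
have [lox ax] := word_value_loxodromic generates_S hyperbolic_X mN m_gt w0 Nw lw.
by exists (word_value (w ++ w2)); split; rewrite ?vertex_dist ?ler_nat.
Qed.
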